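(* Let $N$ be an oriented even-dimensional Riemannian manifold, $M^2$ a Riemann surface, $I\subseteq\mathbb{R}$ an interval around $0$, and let $\psi:I\times M^2\to\Sigma^+N$ be a map $\mathcal{J}^2$-holomorphic to first order. Then $\varphi=\pi\circ\psi:I\times M^2\to N$ is harmonic to first order.
   Context: All maps are smooth; $\varphi_t=\varphi(t,\cdot)$, $\psi_t=\psi(t,\cdot)$; $J$ is the complex structure of $M^2$. $\varphi$ is harmonic to first order if $\varphi_0$ is harmonic and $\nabla^{\varphi^{-1}TN}_{\partial_t|_{t=0}}\tau(\varphi_t)=0$, where $\tau(\varphi_t)=\operatorname{trace}\nabla\mathrm{d}\varphi_t$ is the tension field, computed with any fixed metric in the conformal class of $M^2$ (the notion does not depend on this choice). Twistor space: $\pi:\Sigma^+N\to N$ is the bundle whose fibre at $x$ is the set of orthogonal $J':T_xN\to T_xN$ with $J'^2=-\mathrm{Id}$ that are positive (bases $\{e_1,J'e_1,\dots,e_n,J'e_n\}$ are positively oriented). The Levi-Civita connection on $\mathrm{End}(TN)\supseteq\Sigma^+N$ gives $T\Sigma^+N=\mathcal{H}\oplus\mathcal{V}$ with $\mathcal{V}=\ker\mathrm{d}\pi$, $\mathcal{V}_{(x,J')}=\{\lambda\in\mathfrak{so}(T_xN):\lambda J'=-J'\lambda\}$. $\mathcal{J}^2$ equals $(\mathrm{d}\pi|_{\mathcal{H}})^{-1}\circ J'\circ\mathrm{d}\pi|_{\mathcal{H}}$ on $\mathcal{H}_{(x,J')}$ and $\lambda\mapsto-J'\circ\lambda$ on $\mathcal{V}_{(x,J')}$.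 $\Sigma^+N$ has the metric for which $\mathcal{H}\perp\mathcal{V}$, $\mathrm{d}\pi|_{\mathcal{H}}$ is isometric, and vertical vectors have the inner product $\sum_{i,j}\langle Ve_i,e_j\rangle\langle We_i,e_j\rangle$, $\{e_i\}$ orthonormal; $\nabla$ is its Levi-Civita connection. $\psi$ is $\mathcal{J}^2$-holomorphic to first order if $\psi_0$ is $(J,\mathcal{J}^2)$-holomorphic and $\nabla_{\partial_t|_{t=0}}\{\mathrm{d}\psi_t(JX)-\mathcal{J}^2\mathrm{d}\psi_tX\}=0$ for all $X\in TM$. *)

(* Defs.v *)
(* Tangent vectors are column vectors.  A manifold carries a
   preferred chart [mat p] at each of its points p; the tangent space T_pM is
   'cV[R]_n, read in that preferred chart, so that endomorphisms of T_pM and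
   bilinear forms on T_pM are n x n matrices.  [tcoord i p] passes from T_pM to
   the components with respect to any other chart i around p.  The preferred
   charts are arbitrary and need not vary continuously with p. *)
From HB Require Import structures.
From mathcomp Require Import all_boot all_order all_algebra.
From mathcomp Require Import all_classical all_reals all_analysis.
Set Implicit Arguments.
Unset Strict Implicit.
Unset Printing Implicit Defensive.
Import Order.TTheory GRing.Theory Num.Theory.
Import numFieldNormedType.Exports.
Local Open Scope classical_set_scope.
Local Open Scope ring_scope.

(* C^k and C^oo maps on an open set [U]; [V] is always finite dimensional here,
   so it is enough to iterate directional derivatives. *)
Fixpoint Ck {R : realType} {V W : normedModType R} (k : nat) (U : set V)
    (f : V -> W) : Prop :=
  match k with
  | 0%N => forall x, U x -> {for x, continuous f}
  | k'.+1 => (forall x, U x -> differentiable f x) /\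
             (forall v, Ck k' U (fun x => 'D_v f x))
  end.

Definition smooth_on {R : realType} {V W : normedModType R} (U : set V)
  (f : V -> W) : Prop := forall k, Ck k U f.

Definition basisv {R : realType} {n : nat} (a : 'I_n) : 'cV[R]_n := delta_mx a 0.

Definition jac {R : realType} {m n : nat} (f : 'cV[R]_n -> 'cV[R]_m)
  (x : 'cV[R]_n) : 'M[R]_(m, n) := \matrix_(a, b) ('D_(basisv b) f x) a 0.

Definition bil {R : realType} {n : nat} (G : 'M[R]_n) (v w : 'cV[R]_n) : R :=
  (v^T *m G *m w) 0 0.

Record manifold (R : realType) (n : nat) := Manifold {
  mpt :> topologicalType;
  midx : Type;
  mdom : midx -> set mpt;
  mchart : midx -> mpt -> 'cV[R]_n;
  minv : midx -> 'cV[R]_n -> mpt;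
  mat : mpt -> midx;
  m_hausdorff : hausdorff_space mpt;
  m_second_countable : @second_countable mpt;
  m_open_dom : forall i, open (mdom i);
  m_open_img : forall i, open (mchart i @` mdom i);
  mchartK : forall i p, mdom i p -> minv i (mchart i p) = p;
  mchart_continuous : forall i p, mdom i p -> {for p, continuous (mchart i)};
  minv_continuous :
    forall i x, (mchart i @` mdom i) x -> {for x, continuous (minv i)};
  m_transition_smooth : forall i j,
    smooth_on (mchart i @` (mdom i `&` mdom j)) (mchart j \o minv i);
  mat_dom : forall p, mdom (mat p) p
}.

(* Matrix of the isomorphism T_pM -> R^n given by the chart i around p. *)
Definition tcoord {R : realType} {n : nat} {M : manifold R n} (i : midx M)
    (p : M) : 'M[R]_n :=
  jac (mchart i \o minv (mat p)) (mchart (mat p) p).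

(* [g p] is the Gram matrix of the inner product of T_pM; [metric_coord g i] is
   the matrix (g_ab) of the metric in the chart i. *)
Definition metric_coord {R : realType} {n : nat} {M : manifold R n}
    (g : M -> 'M[R]_n) (i : midx M) (x : 'cV[R]_n) : 'M[R]_n :=
  let p := minv i x in
  let S := invmx (tcoord i p) in S^T *m g p *m S.

Record riem_metric (R : realType) (n : nat) (M : manifold R n) := RiemMetric {
  rm :> M -> 'M[R]_n;
  rm_sym : forall p, (rm p)^T = rm p;
  rm_pos : forall p v, v != 0 -> 0 < bil (rm p) v v;
  rm_smooth : forall i : midx M,
    smooth_on (mchart i @` mdom i) (metric_coord rm i)
}.

(* A basis of T_pM (the columns of B) is positively oriented iff
   0 < or_sign p * \det B.  The last condition says that the orientation of the
   tangent spaces is locally constant when read in a chart. *)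
Record orientation (R : realType) (n : nat) (M : manifold R n) := Orientation {
  or_sign : M -> R;
  or_sign1 : forall p, or_sign p = 1 \/ or_sign p = -1;
  or_locally_constant : forall (i : midx M) p, mdom i p ->
    \forall q \near p,
      0 < (or_sign q * \det (tcoord i q)) * (or_sign p * \det (tcoord i p))
}.

(* Multiplication by the imaginary unit on R^2 = C. *)
Definition J0 {R : realType} : 'M[R]_2 :=
  \matrix_(a, b) (if (a == 1) && (b == 0) then 1
                  else if (a == 0) && (b == 1) then -1 else 0).

(* The transition maps are smooth and satisfy the Cauchy-Riemann equations,
   i.e. are holomorphic.  The complex structure J of the surface is then J0 in
   every chart, in particular J0 on every tangent space. *)
Record riemann_surface (R : realType) := RiemannSurface {
  rs_manifold :> manifold R 2;
  rs_holomorphic : forall (i j : midx rs_manifold) x,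
    (mchart i @` (mdom i `&` mdom j)) x ->
    jac (mchart j \o minv i) x *m J0 = J0 *m jac (mchart j \o minv i) x
}.

Definition in_conformal_class {R : realType} {M : riemann_surface R}
    (h : riem_metric M) : Prop :=
  forall p v w, bil (h p) (J0 *m v) (J0 *m w) = bil (h p) v w.

(* Gamma(v, w), with components
   G^kl/2 (d_v G(w, e_l) + d_w G(v, e_l) - d_l G(v, w)). *)
Definition christoffel {R : realType} {n : nat} (G : 'cV[R]_n -> 'M[R]_n)
    (x v w : 'cV[R]_n) : 'cV[R]_n :=
  invmx (G x) *m
  \col_l (2^-1 * (bil ('D_v G x) w (basisv l) + bil ('D_w G x) v (basisv l)
                  - bil ('D_(basisv l) G x) v w)).

Definition christoffel_mx {R : realType} {n : nat} (G : 'cV[R]_n -> 'M[R]_n)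
    (x v : 'cV[R]_n) : 'M[R]_n :=
  \matrix_(k, l) (christoffel G x v (basisv l)) k 0.

(* Covariant derivative at time t of the vector field s along the curve c. *)
Definition cov_deriv {R : realType} {n : nat} (G : 'cV[R]_n -> 'M[R]_n)
    (c s : R -> 'cV[R]_n) (t : R) : 'cV[R]_n :=
  derive1 s t + christoffel G (c t) (derive1 c t) (s t).

(* (nabla df)(v, w) for f : (R^m, H) -> (R^n, G). *)
Definition second_fund_form {R : realType} {m n : nat}
    (H : 'cV[R]_m -> 'M[R]_m) (G : 'cV[R]_n -> 'M[R]_n)
    (f : 'cV[R]_m -> 'cV[R]_n) (x v w : 'cV[R]_m) : 'cV[R]_n :=
  'D_v (fun y => 'D_w f y) x - 'D_(christoffel H x v w) f x
  + christoffel G (f x) ('D_v f x) ('D_w f x).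

Definition tension {R : realType} {m n : nat}
    (H : 'cV[R]_m -> 'M[R]_m) (G : 'cV[R]_n -> 'M[R]_n)
    (f : 'cV[R]_m -> 'cV[R]_n) (x : 'cV[R]_m) : 'cV[R]_n :=
  \sum_a \sum_b
    (invmx (H x)) a b *: second_fund_form H G f x (basisv a) (basisv b).

(* A map I x M -> Z is represented by f : R -> M -> Z, of which only the values
   f t, t in I, matter.  Here D is the domain of a coordinate system
   c : Z -> E, and f is read in the chart i of M and in c.  As I may contain
   its end points, smoothness on I x M means that f is locally the restriction
   of a map that is smooth on an open set. *)
Definition smooth_rep {R : realType} {m : nat} {M : manifold R m} {Z : Type}
    {E : normedModType R} (I : set R) (t : R) (i : midx M) (p : M)
    (D : set Z) (c : Z -> E) (f : R -> M -> Z) : Prop :=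
  exists (O : set (R^o * 'cV[R]_m)%type) (F : (R^o * 'cV[R]_m)%type -> E),
    [/\ open O, O (t, mchart i p), smooth_on O F &
      forall s x, O (s, x) -> I s ->
        [/\ (mchart i @` mdom i) x, D (f s (minv i x))
          & c (f s (minv i x)) = F (s, x)]].

Definition smooth_family {R : realType} {m n : nat} {M : manifold R m}
    {N : manifold R n} (I : set R) (phi : R -> M -> N) : Prop :=
  forall t (p : M) (i : midx M) (j : midx N),
    I t -> mdom i p -> mdom j (phi t p) ->
    smooth_rep I t i p (mdom j) (mchart j) phi.

Definition map_coord {R : realType} {m n : nat} {M : manifold R m}
    {N : manifold R n} (i : midx M) (j : midx N) (phi : M -> N)
    (x : 'cV[R]_m) : 'cV[R]_n := mchart j (phi (minv i x)).

(* tau(phi) is computed in the charts i and j; x is the chart-i coordinate of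
   the point. *)
Definition tension_coord {R : realType} {m n : nat} {M : manifold R m}
    {N : manifold R n} (h : riem_metric M) (g : riem_metric N)
    (i : midx M) (j : midx N) (phi : M -> N) (x : 'cV[R]_m) : 'cV[R]_n :=
  tension (metric_coord h i) (metric_coord g j) (map_coord i j phi) x.

Definition harmonic {R : realType} {m n : nat} {M : manifold R m}
    {N : manifold R n} (h : riem_metric M) (g : riem_metric N)
    (phi : M -> N) : Prop :=
  forall (p : M) (i : midx M) (j : midx N), mdom i p -> mdom j (phi p) ->
    tension_coord h g i j phi (mchart i p) = 0.

Definition harmonic_to_first_order {R : realType} {m n : nat}
    {M : manifold R m} {N : manifold R n} (h : riem_metric M)
    (g : riem_metric N) (I : set R) (phi : R -> M -> N) : Prop :=
  [/\ smooth_family I phi,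
      harmonic h g (phi 0) &
      forall (p : M) (i : midx M) (j : midx N),
        mdom i p -> mdom j (phi 0 p) ->
        let x := mchart i p in
        cov_deriv (metric_coord g j)
          (fun t => map_coord i j (phi t) x)
          (fun t => tension_coord h g i j (phi t) x) 0 = 0].

(* The family (e_1, J e_1, ..., e_n, J e_n), as the columns of a matrix; only
   the first n terms of e are used. *)
Definition adapted_mx {R : realType} {n : nat} (J : 'M[R]_n.*2)
    (e : nat -> 'cV[R]_n.*2) : 'M[R]_n.*2 :=
  \matrix_(r, k) (if odd k then J *m e k./2 else e k./2) r 0.

Definition positive_cx {R : realType} {n : nat} {N : manifold R n.*2}
    (o : orientation N) (x : N) (J : 'M[R]_n.*2) : Prop :=
  forall e, \det (adapted_mx J e) != 0 ->
    0 < or_sign o x * \det (adapted_mx J e).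

Record twistor {R : realType} {n : nat} {N : manifold R n.*2}
    (g : riem_metric N) (o : orientation N) := Twistor {
  tw_base : N;
  tw_J : 'M[R]_n.*2;
  tw_orthogonal : forall v w,
    bil (g tw_base) (tw_J *m v) (tw_J *m w) = bil (g tw_base) v w;
  tw_square : tw_J *m tw_J = - 1%:M;
  tw_positive : positive_cx o tw_base tw_J
}.

(* Chart j of N gives coordinates (x, A) on End(TN), hence on the twistor
   space, which is a submanifold of End(TN). *)
Notation EndCoord R m := ('cV[R]_m * 'M[R]_m)%type.

Definition tw_dom {R : realType} {n : nat} {N : manifold R n.*2}
    {g : riem_metric N} {o : orientation N} (j : midx N)
    : set (twistor g o) := [set z | mdom j (tw_base z)].

Definition tw_coord {R : realType} {n : nat} {N : manifold R n.*2}
    {g : riem_metric N} {o : orientation N} (j : midx N) (z : twistor g o)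
    : EndCoord R n.*2 :=
  let T := tcoord j (tw_base z) in
  (mchart j (tw_base z), T *m tw_J z *m invmx T).

Definition smooth_tw_family {R : realType} {n m : nat} {N : manifold R n.*2}
    {g : riem_metric N} {o : orientation N} {M : manifold R m}
    (I : set R) (psi : R -> M -> twistor g o) : Prop :=
  forall t (p : M) (i : midx M) (j : midx N),
    I t -> mdom i p -> tw_dom j (psi t p) ->
    smooth_rep I t i p (tw_dom j) (tw_coord j) psi.

(* The splitting of T End(TN) at the point z = (x, A) of the coordinates above,
   G being the metric of N in the chart: the horizontal lift of v is the
   velocity (v, B) of the parallel displacement of A in the direction v, for
   which B + [Gamma_v, A] = 0. *)
Definition hlift {R : realType} {m : nat} (G : 'cV[R]_m -> 'M[R]_m)
    (z : EndCoord R m) (v : 'cV[R]_m) : EndCoord R m :=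
  let C := christoffel_mx G z.1 v in (v, - (C *m z.2 - z.2 *m C)).

Definition vpart {R : realType} {m : nat} (G : 'cV[R]_m -> 'M[R]_m)
    (z Y : EndCoord R m) : 'M[R]_m := Y.2 - (hlift G z Y.1).2.

Definition J2 {R : realType} {m : nat} (G : 'cV[R]_m -> 'M[R]_m)
    (z Y : EndCoord R m) : EndCoord R m :=
  hlift G z (z.2 *m Y.1) + (0, - (z.2 *m vpart G z Y)).

(* Some orthonormal basis (e_1, ..., e_m), as the columns of a matrix. *)
Definition onb {R : realType} {m : nat} (G : 'M[R]_m) : 'M[R]_m :=
  xget 0 [set B : 'M[R]_m | B^T *m G *m B = 1%:M].

Definition vert_ip {R : realType} {m : nat} (G V W : 'M[R]_m) : R :=
  let e := onb G in
  \sum_i \sum_j bil G (V *m col i e) (col j e) * bil G (W *m col i e) (col j e).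

Definition tw_ip {R : realType} {m : nat} (G : 'cV[R]_m -> 'M[R]_m)
    (z Y Y' : EndCoord R m) : R :=
  bil (G z.1) Y.1 Y'.1 + vert_ip (G z.1) (vpart G z Y) (vpart G z Y').

(* kappa : U -> S is a local parametrization (inverse of a chart) of the
   embedded submanifold S of E: its image is relatively open in S and its
   inverse is the restriction of a smooth map rho defined on an open set. *)
Definition local_param {R : realType} {E : normedModType R} (S : set E)
    {d : nat} (U : set 'cV[R]_d) (kappa : 'cV[R]_d -> E) (O : set E)
    (rho : E -> 'cV[R]_d) : Prop :=
  [/\ open U, open O, smooth_on U kappa, smooth_on O rho &
      kappa @` U = S `&` O /\ forall u, U u -> rho (kappa u) = u].

(* W is the covariant derivative at time t, for the Levi-Civita connection of
   the twistor space, of the vector field Y along the curve c.  Everything is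
   read in the chart j of N; then u and s are the components of c and Y in a
   local parametrization kappa of the twistor space. *)
Definition tw_cov_deriv {R : realType} {n : nat} {N : manifold R n.*2}
    (g : riem_metric N) (o : orientation N) (j : midx N)
    (c Y : R -> EndCoord R n.*2) (t : R) (W : EndCoord R n.*2) : Prop :=
  exists (d : nat) (U : set 'cV[R]_d) (kappa : 'cV[R]_d -> EndCoord R n.*2)
         (O : set (EndCoord R n.*2)) (rho : EndCoord R n.*2 -> 'cV[R]_d)
         (u s : R -> 'cV[R]_d),
    let metric y := \matrix_(a, b)
      tw_ip (metric_coord g j) (kappa y)
        ('D_(basisv a) kappa y) ('D_(basisv b) kappa y) in
    [/\ local_param (tw_coord j @` (tw_dom j : set (twistor g o)))
          U kappa O rho,
        \forall r \near t,
          [/\ U (u r), c r = kappa (u r) & Y r = 'D_(s r) kappa (u r)] &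
        W = 'D_(cov_deriv metric u s t) kappa (u t)].

(* d psi (J X) - J^2 (d psi X) at the point x of the chart i, in the
   coordinates of End(TN) given by the chart j. *)
Definition J2_defect {R : realType} {n : nat} {N : manifold R n.*2}
    {g : riem_metric N} {o : orientation N} {M : riemann_surface R}
    (i : midx M) (j : midx N) (psi : M -> twistor g o) (x X : 'cV[R]_2)
    : EndCoord R n.*2 :=
  let Psi y := tw_coord j (psi (minv i y)) in
  'D_(J0 *m X) Psi x - J2 (metric_coord g j) (Psi x) ('D_X Psi x).

Definition J2_holomorphic {R : realType} {n : nat} {N : manifold R n.*2}
    {g : riem_metric N} {o : orientation N} {M : riemann_surface R}
    (psi : M -> twistor g o) : Prop :=
  forall (p : M) (i : midx M) (j : midx N),
    mdom i p -> tw_dom j (psi p) ->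
    forall X, J2_defect i j psi (mchart i p) X = 0.

Definition J2_holomorphic_to_first_order {R : realType} {n : nat}
    {N : manifold R n.*2} {g : riem_metric N} {o : orientation N}
    {M : riemann_surface R} (I : set R) (psi : R -> M -> twistor g o) : Prop :=
  [/\ smooth_tw_family I psi,
      J2_holomorphic (psi 0) &
      forall (p : M) (i : midx M) (j : midx N),
        mdom i p -> tw_dom j (psi 0 p) ->
        let x := mchart i p in
        forall X, tw_cov_deriv g o j
          (fun t => tw_coord j (psi t (minv i x)))
          (fun t => J2_defect i j (psi t) x X) 0 0].

(* Main.v *)
From HB Require Import structures.
Require Import Defs.
From mathcomp Require Import all_boot all_order all_algebra perm ring.
From mathcomp Require Import all_classical all_reals all_analysis.
Import Order.TTheory GRing.Theory Num.Theory.
Import numFieldNormedType.Exports.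
Local Open Scope classical_set_scope.
Local Open Scope ring_scope.
Set Implicit Arguments.
Unset Strict Implicit.
Unset Printing Implicit Defensive.

(** In a chart of [M] and a chart of [N] the family psi is a pair (f, A): f is
    the coordinate expression of phi, and A is a field of endomorphisms along f
    with A^2 = -1.  Let e_0, e_1 = J e_0 be the coordinate vectors of the chart
    of [M], write f_b for the derivative of f along e_b, nabla for the
    Levi-Civita connection of [N] pulled back by f, and V_b = nabla_b A.  The
    defect of J^2-holomorphy in the direction X has a horizontal part alpha(X)
    and a vertical part beta(X), where
    alpha(e_0) = f_1 - A f_0,  alpha(e_1) = - f_0 - A f_1  and
    beta(e_0) = V_1 + A V_0.  Differentiate alpha(e_0) and alpha(e_1)
    covariantly along e_1 and e_0 and subtract.  As nabla is torsion free
    and V_0 A = - A V_0, this gives the identity ([euclidean_tensionE])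

      nabla_0 f_0 + nabla_1 f_1 = beta(e_0) f_0 - V_0 alpha(e_0)
                                  + nabla_1 alpha(e_0) - nabla_0 alpha(e_1),

    valid for any such f and A.  Its left-hand side is a multiple of the tension
    field of phi by a function on [M], because the metric of [M] is lambda times
    the identity in a holomorphic chart and dimension two makes the trace of its
    Christoffel symbols vanish ([tension_conformal]).

    It remains to see that the right-hand side vanishes to first order in t.
    At t = 0 the defect is zero.  The covariant derivative of a vector field at
    a zero of the field is its ordinary derivative, for any connection; hence
    the hypothesis on the Levi-Civita connection of the twistor space says that
    the t-derivative of the defect in coordinates is zero as well
    ([tw_cov_deriv_eq0]).  So alpha and beta vanish to first order at every point of [M], and so do their derivatives
    along [M], since mixed partial derivatives commute
    ([schwarz], [flat_derive_slice]).  Finally, the tension field is zero at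
    t = 0, and the same remark identifies its t-derivative in coordinates with
    its covariant derivative along t. *)

(** * Derivatives of matrix-valued functions *)

Section Calculus.
Context {R : realType}.

Lemma deriveDl (V W : normedModType R) (f : V -> W) x u v :
  differentiable f x -> 'D_(u + v) f x = 'D_u f x + 'D_v f x.
Proof. by move=> df; rewrite !deriveE// linearD. Qed.

Lemma deriveZl (V W : normedModType R) (f : V -> W) x (k : R) v :
  differentiable f x -> 'D_(k *: v) f x = k *: 'D_v f x.
Proof. by move=> df; rewrite !deriveE// linearZ. Qed.

Lemma deriveNl (V W : normedModType R) (f : V -> W) x v :
  differentiable f x -> 'D_(- v) f x = - 'D_v f x.
Proof. by move=> df; rewrite !deriveE// linearN. Qed.

Lemma derive_suml (V W : normedModType R) (f : V -> W) x (I : finType)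
    (k : I -> R) (e : I -> V) :
  differentiable f x ->
  'D_(\sum_i k i *: e i) f x = \sum_i k i *: 'D_(e i) f x.
Proof.
move=> df; rewrite deriveE// linear_sum; apply: eq_bigr => i _.
by rewrite linearZ deriveE.
Qed.

Lemma derive_comp_lin (V W W' : normedModType R) (L : {linear W -> W'})
    (f : V -> W) x v :
  continuous L -> differentiable f x -> 'D_v (L \o f) x = L ('D_v f x).
Proof.
move=> cL df; have dL := linear_differentiable (f x) cL.
rewrite deriveE; last exact: differentiable_comp.
by rewrite diff_comp//= diff_lin// -deriveE.
Qed.

Lemma derive_comp (U V W : normedModType R) (f : U -> V) (g : V -> W) x v :
  differentiable f x -> differentiable g (f x) ->
  'D_v (g \o f) x = 'D_('D_v f x) g (f x).
Proof.
move=> df dg; rewrite deriveE; last exact: differentiable_comp.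
by rewrite diff_comp//= deriveE// deriveE.
Qed.

Lemma differentiable_mxP (V : normedModType R) m n (f : V -> 'M[R]_(m, n)) x :
  differentiable f x <-> forall i j, differentiable (fun y => f y i j) x.
Proof.
split=> [df i j|df].
  exact: (differentiable_comp df (differentiable_coord (f x) i j)).
have -> : f = \sum_(i < m) \sum_(j < n) (fun y => f y i j *: delta_mx i j).
  apply/funext => y; rewrite [LHS]matrix_sum_delta fct_sumE.
  by apply: eq_bigr => i _; rewrite fct_sumE.
apply: differentiable_sum => i; apply: differentiable_sum => j.
exact: differentiableZl.
Qed.

Lemma deriv_mxE (V : normedModType R) m n (f : V -> 'M[R]_(m, n)) x v i j :
  differentiable f x -> ('D_v f x) i j = 'D_v (fun y => f y i j) x.
Proof. by move=> df; rewrite derive_mx ?mxE//; exact: diff_derivable. Qed.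

Lemma differentiable_big_sum (V W : normedModType R) (I : finType)
    (f : I -> V -> W) x :
  (forall i, differentiable (f i) x) ->
  differentiable (fun y => \sum_i f i y) x.
Proof.
move=> df; rewrite (_ : (fun y => _) = \sum_i f i); last first.
  by apply/funext => y; rewrite fct_sumE.
apply: (big_ind (fun g : V -> W => differentiable g x)) => //.
by move=> g h; exact: differentiableD.
Qed.

Lemma derive_big_sum (V W : normedModType R) (I : finType)
    (f : I -> V -> W) x v :
  (forall i, differentiable (f i) x) ->
  'D_v (fun y => \sum_i f i y) x = \sum_i 'D_v (f i) x.
Proof.
move=> df; rewrite (_ : (fun y => _) = \sum_i f i); last first.
  by apply/funext => y; rewrite fct_sumE.
suff [] : differentiable (\sum_i f i) x /\
  'D_v (\sum_i f i) x = \sum_i 'D_v (f i) x by [].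
apply: (big_ind2 (fun (g : V -> W) d => differentiable g x /\ 'D_v g x = d)).
- by split; [exact: (differentiable_cst (0 : W))|exact: (derive_cst (0 : W))].
- move=> g d h e [dg <-] [dh <-]; split; first exact: differentiableD.
  by apply: deriveD; exact: diff_derivable.
- by [].
Qed.

Lemma differentiable_mulmx (V : normedModType R) m n p
    (f : V -> 'M[R]_(m, n)) (g : V -> 'M[R]_(n, p)) x :
  differentiable f x -> differentiable g x ->
  differentiable (fun y => f y *m g y) x.
Proof.
move=> /differentiable_mxP df /differentiable_mxP dg.
apply/differentiable_mxP => i j.
under eq_fun do rewrite mxE.
apply: differentiable_big_sum => k.
exact: (differentiableM (df i k) (dg k j)).
Qed.

Lemma derive_mulmx (V : normedModType R) m n p
    (f : V -> 'M[R]_(m, n)) (g : V -> 'M[R]_(n, p)) x v :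
  differentiable f x -> differentiable g x ->
  'D_v (fun y => f y *m g y) x = 'D_v f x *m g x + f x *m 'D_v g x.
Proof.
move=> df dg; apply/matrixP => i j.
rewrite deriv_mxE; last exact: differentiable_mulmx.
under eq_fun do rewrite mxE.
move/differentiable_mxP : (df) => df'; move/differentiable_mxP : (dg) => dg'.
rewrite derive_big_sum; last first.
  by move=> k; exact: (differentiableM (df' i k) (dg' k j)).
rewrite !mxE -big_split; apply: eq_bigr => k _ /=.
rewrite [LHS](@deriveM _ _ (fun y => f y i k) (fun y => g y k j));
  do ?exact: diff_derivable.
by rewrite addrC -!deriv_mxE//; congr (_ + _); exact: mulrC.
Qed.

Lemma scale_is_bilinear (W : normedModType R) :
  bilinear_for
    (GRing.Scale.Law.clone _ _ *:%R _) (GRing.Scale.Law.clone _ _ *:%R _)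
    (@GRing.scale R W : R -> W -> W).
Proof.
split=> [u'|u] a x y /=.
- by rewrite scalerDl scalerA.
- by rewrite scalerDr !scalerA mulrC.
Qed.
HB.instance Definition _ (W : normedModType R) :=
  bilinear_isBilinear.Build R R W W _ _ (@GRing.scale R W)
  (scale_is_bilinear W).

Lemma differentiable_scale (V W : normedModType R) (k : V -> R) (g : V -> W) x :
  differentiable k x -> differentiable g x ->
  differentiable (fun y => k y *: g y) x.
Proof.
move=> dk dg.
apply: (@differentiable_comp _ _ _ _ (fun y => (k y, g y)) (fun p =>
  p.1 *: p.2)).
  exact: differentiable_pair.
by apply: differentiable_bilin => p; exact: scale_continuous.
Qed.

Lemma derive_scale (V W : normedModType R) (k : V -> R) (g : V -> W) x v :
  differentiable k x -> differentiable g x ->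
  'D_v (fun y => k y *: g y) x = 'D_v k x *: g x + k x *: 'D_v g x.
Proof.
move=> dk dg.
have dp := differentiable_pair dk dg.
have db : differentiable (fun p : R * W => p.1 *: p.2) (k x, g x).
  by apply: differentiable_bilin => p; exact: scale_continuous.
rewrite [LHS](@derive_comp _ _ _ (fun y => (k y, g y)) (fun p => p.1 *: p.2))//.
rewrite deriveE// diff_bilin; last by move=> p; exact: scale_continuous.
by rewrite deriveE// diff_pair//= !deriveE// addrC.
Qed.

End Calculus.

(** * Smooth maps *)

Section Ck.
Context {R : realType}.

Lemma near_eq_differentiable (V W : normedModType R) (f g : V -> W) x :
  {near x, f =1 g} -> differentiable f x -> differentiable g x.
Proof.
move=> fg df; have fgx : f x = g x := nbhs_singleton fg.
suff E : g \o shift x = cst (g x) + 'd f x +o_ 0 id.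
  have cdf := diff_continuous df.
  by apply/diff_locallyP; rewrite (diff_unique cdf E).
apply/eqaddoP => _/posnumP[e].
have /eqaddoP /(_ e%:num) /(_ [gt0 of e%:num]) := diff_locally df.
have fg0 : \forall h \near (0 : V), f (h + x) = g (h + x).
  have c : (h + x) @[h --> (0 : V)] --> x.
    by rewrite -[X in _ --> X]add0r; apply: cvgD;
      [exact: cvg_id|exact: cvg_cst].
  exact: c _ fg.
apply: filter_app; near=> h.
rewrite /= -![(_ + _ : _ -> _) _]/(_ + _) -![(- _ : _ -> _) _]/(- _) /=.
rewrite -fgx; suff -> : f (h + x) = g (h + x) by [].
by near: h.
Unshelve. all: by end_near. Qed.

Lemma open_near_eq (V : topologicalType) (W : Type) (U : set V) (f g : V -> W)
    x : open U -> U x -> (forall y, U y -> f y = g y) -> {near x, f =1 g}.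
Proof.
by move=> oU Ux fg; apply: filterS (open_nbhs_nbhs (conj oU Ux)) => y /fg.
Qed.

Lemma Ck_ext (V W : normedModType R) k (U : set V) (f g : V -> W) :
  open U -> (forall x, U x -> f x = g x) -> Ck k U f -> Ck k U g.
Proof.
move=> oU; elim: k f g => [|k IH] f g fg /=.
  move=> cf x Ux; have nfg := open_near_eq oU Ux fg.
  rewrite /prop_for /continuous_at -(fg _ Ux).
  by apply: cvg_trans (cf _ Ux); apply: near_eq_cvg.
move=> [df Dc]; split=> [x Ux|v].
  by apply: near_eq_differentiable (df _ Ux); exact: open_near_eq fg.
apply: IH (Dc v) => x Ux; apply: near_eq_derive; exact: open_near_eq fg.
Qed.

Lemma CkS (V W : normedModType R) k (U : set V) (f : V -> W) :
  Ck k.+1 U f -> Ck k U f.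
Proof.
elim: k f => [|k IH] f [df Dc].
  move=> x Ux; apply: differentiable_continuous; exact: df.
split=> // v; exact: (IH _ (Dc v)).
Qed.

Lemma smooth_differentiable (V W : normedModType R) (U : set V) (f : V -> W) x :
  smooth_on U f -> U x -> differentiable f x.
Proof. by move=> sf Ux; have [df _] := sf 1%N; exact: df. Qed.

Lemma smooth_derive (V W : normedModType R) (U : set V) (f : V -> W) v :
  smooth_on U f -> smooth_on U (fun x => 'D_v f x).
Proof. by move=> sf k; have [_ D] := sf k.+1; exact: D. Qed.

Lemma smooth_sub (V W : normedModType R) (U U' : set V) (f : V -> W) :
  U' `<=` U -> smooth_on U f -> smooth_on U' f.
Proof.
move=> UU + k; move=> /(_ k); elim: k f => [|k IH] f /=.
  by move=> cf x /UU; exact: cf.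
by move=> [df Dc]; split=> [x /UU|v]; [exact: df|exact: IH (Dc v)].
Qed.

Lemma smooth_lin (V W W' : normedModType R) (U : set V) (L : {linear W -> W'})
    (f : V -> W) : open U -> continuous L ->
  smooth_on U f -> smooth_on U (L \o f).
Proof.
move=> oU cL + k; move=> /(_ k); elim: k f => [|k IH] f /=.
  by move=> cf x Ux; apply: continuous_comp; [exact: cf|exact: cL].
move=> [df Dc]; split=> [x Ux|v].
  by apply: differentiable_comp (df _ Ux) _; exact: linear_differentiable.
apply: (@Ck_ext _ _ _ _ (L \o (fun x => 'D_v f x))) => //;
  last exact: IH (Dc v).
by move=> x Ux; rewrite derive_comp_lin//; exact: df.
Qed.

Lemma CkB (V W : normedModType R) k (U : set V) (f g : V -> W) :
  open U -> Ck k U f -> Ck k U g -> Ck k U (fun x => f x - g x).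
Proof.
move=> oU; elim: k f g => [|k IH] f g /=.
  by move=> cf cg x Ux; apply: continuousB; [exact: cf|exact: cg].
move=> [df Df] [dg Dg]; split=> [x Ux|v].
  by apply: differentiableB; [exact: df|exact: dg].
apply: Ck_ext (IH _ _ (Df v) (Dg v)) => // x Ux.
by rewrite -deriveB//; apply: diff_derivable; [exact: df|exact: dg].
Qed.

Lemma CkD (V W : normedModType R) k (U : set V) (f g : V -> W) :
  open U -> Ck k U f -> Ck k U g -> Ck k U (fun x => f x + g x).
Proof.
move=> oU; elim: k f g => [|k IH] f g /=.
  by move=> cf cg x Ux; apply: continuousD; [exact: cf|exact: cg].
move=> [df Df] [dg Dg]; split=> [x Ux|v].
  by apply: differentiableD; [exact: df|exact: dg].
apply: Ck_ext (IH _ _ (Df v) (Dg v)) => // x Ux.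
by rewrite -deriveD//; apply: diff_derivable; [exact: df|exact: dg].
Qed.

Lemma continuous_fst (V W : normedModType R) :
  continuous (fst : (V * W)%type -> V).
Proof. by move=> [a b]; exact: cvg_fst. Qed.

Lemma continuous_snd (V W : normedModType R) :
  continuous (snd : (V * W)%type -> W).
Proof. by move=> [a b]; exact: cvg_snd. Qed.

Lemma continuous_mulmx (m n p : nat) :
  continuous (fun q : 'M[R]_(m, n) * 'M[R]_(n, p) => q.1 *m q.2).
Proof.
move=> q; apply: differentiable_continuous; apply: differentiable_mulmx.
  by apply: (@linear_differentiable _ _ _ fst); exact: continuous_fst.
by apply: (@linear_differentiable _ _ _ snd); exact: continuous_snd.
Qed.

Lemma Ck_mulmx (V : normedModType R) m n p k (U : set V)
    (f : V -> 'M[R]_(m, n)) (g : V -> 'M[R]_(n, p)) :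
  open U -> Ck k U f -> Ck k U g -> Ck k U (fun x => f x *m g x).
Proof.
move=> oU; elim: k f g => [|k IH] f g.
  move=> cf cg x Ux.
  apply: (@continuous_comp _ _ _ (fun x => (f x, g x)) (fun q => q.1 *m q.2)).
    exact: (cvg_pair (cf x Ux) (cg x Ux)).
  exact: (@continuous_mulmx _ _ _ (f x, g x)).
move=> Cf Cg; have [[df Df] [dg Dg]] := (Cf, Cg); split=> [x Ux|v].
  by apply: differentiable_mulmx; [exact: df|exact: dg].
apply: Ck_ext (CkD oU (IH _ _ (Df v) (CkS Cg)) (IH _ _ (CkS Cf) (Dg v))) => //.
by move=> x Ux; rewrite derive_mulmx//; [exact: df|exact: dg].
Qed.

End Ck.

(** * Symmetry of second derivatives *)

Section Schwarz.
Context {R : realType} {V : normedModType R}.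

Lemma growth_line (W : normedModType R) (f : V -> W) (p u : V) (s h : R) :
  h^-1 *: (f (p + (h *: (1 : R) + s) *: u) - f (p + s *: u)) =
  h^-1 *: (f (h *: u + (p + s *: u)) - f (p + s *: u)).
Proof.
by rewrite scalerDl addrCA /GRing.scale/= mulr1.
Qed.

Lemma is_derive_line (W : normedModType R) (f : V -> W) (p u : V) (s : R) :
  derivable f (p + s *: u) u ->
  is_derive s 1 (fun r : R => f (p + r *: u)) ('D_u f (p + s *: u)).
Proof.
move=> df.
have E : (fun h : R => h^-1 *: (((fun r : R =>
  f (p + r *: u)) \o shift s) (h *: 1)
    - f (p + s *: u))) =
  (fun h : R => h^-1 *: ((f \o shift (p + s *: u)) (h *: u) - f (p + s *: u))).
  by apply/funext => h /=; rewrite growth_line.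
by split; [rewrite /derivable E | rewrite /derive E].
Qed.

(** The mean value theorem, applied to the increment of [f] in the direction
    [h *: v] and then to the derivative of [f] along [u], evaluates the second
    difference of [f] over a small parallelogram.  The second difference is
    symmetric in [u] and [v], which is what makes mixed derivatives commute. *)
Lemma second_difference (U : set V) (f : V -> R) x u v :
  nbhs x U -> (forall y, U y -> differentiable f y) ->
  (forall y, U y -> differentiable (fun z => 'D_u f z) y) ->
  exists2 d : R, 0 < d & forall h, 0 < h -> h < d ->
    exists2 y, U y & f (x + h *: v + h *: u) - f (x + h *: u)
      - (f (x + h *: v) - f x) = 'D_v (fun z => 'D_u f z) y * h * h.
Proof.
move=> /nbhs_ballP[e e0 eU] df ddf.
pose w := `|u| + `|v| + 1.
have w0 : 0 < w by rewrite /w ltr_wpDl// addr_ge0.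
exists (e / w); first by rewrite divr_gt0.
move=> h h0 hd.
have inU a b : 0 <= a <= h -> 0 <= b <= h -> U (x + b *: v + a *: u).
  move=> /andP[a0 ah] /andP[b0 bh]; apply: eU; rewrite -ball_normE/= -addrA.
  rewrite opprD addNKr normrN (le_lt_trans
    (ler_normD _ _))// !normrZ !ger0_norm//.
  move: hd; rewrite ltr_pdivlMr//; apply: le_lt_trans.
  rewrite /w !mulrDr mulr1 addrC -[leLHS]addr0; apply: lerD (ltW h0).
  by apply: lerD; rewrite ler_wpM2r.
have hh : 0 <= h <= h by rewrite lexx ltW.
have h00 : (0 : R) <= 0 <= h by rewrite lexx ltW.
have dphi s : 0 <= s <= h -> is_derive s 1
    (fun r => f (x + h *: v + r *: u) - f (x + r *: u))
    ('D_u f (x + h *: v + s *: u) - 'D_u f (x + s *: u)).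
  move=> sh; apply: is_deriveB.
    by apply: is_derive_line; apply: diff_derivable; apply: df; exact: inU.
  apply: is_derive_line; apply: diff_derivable; apply: df.
  by have := inU _ _ sh h00; rewrite scale0r addr0.
have [||a + Ea] := MVT_segment (ltW h0) (f := fun r =>
  f (x + h *: v + r *: u) - f (x + r *: u))
    (df := fun s => 'D_u f (x + h *: v + s *: u) - 'D_u f (x + s *: u)).
- by move=> s; rewrite in_itv/= => /andP[? ?]; apply: dphi; rewrite !ltW.
- by apply: derivable_within_continuous => s; rewrite in_itv/= => /dphi[].
rewrite in_itv/= => ah.
have dpsi s : 0 <= s <= h -> is_derive s 1
    (fun r => 'D_u f (x + a *: u + r *: v))
    ('D_v (fun z => 'D_u f z) (x + a *: u + s *: v)).
  move=> sh; apply: (is_derive_line (f := fun z => 'D_u f z)).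
  by apply: diff_derivable; apply: ddf; rewrite addrAC; exact: inU.
have [||b + Eb] := MVT_segment (ltW h0) (f := fun r =>
  'D_u f (x + a *: u + r *: v))
    (df := fun s => 'D_v (fun z => 'D_u f z) (x + a *: u + s *: v)).
- by move=> s; rewrite in_itv/= => /andP[? ?]; apply: dpsi; rewrite !ltW.
- by apply: derivable_within_continuous => s; rewrite in_itv/= => /dpsi[].
rewrite in_itv/= => bh.
exists (x + a *: u + b *: v); first by rewrite addrAC; exact: inU.
move: Ea Eb; rewrite !scale0r !addr0 !subr0 => -> .
by rewrite (addrAC x (h *: v)) => ->.
Qed.

(** Both mixed derivatives are the limit of the same second differences,
    divided by [h ^+ 2]. *)
Lemma schwarz_scalar (U : set V) (f : V -> R) x u v :
  open U -> U x -> Ck 2 U f ->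
  'D_u (fun y => 'D_v f y) x = 'D_v (fun y => 'D_u f y) x.
Proof.
move=> oU Ux [df ddf].
set a := LHS; set b := RHS.
apply/eqP; rewrite -subr_eq0 -normr_le0; apply/ler_addgt0Pl => e e0;
  rewrite addr0.
have e20 : 0 < e / 2 by rewrite divr_gt0.
have cu : \forall y \near x, `|a - 'D_u (fun z => 'D_v f z) y| < e / 2.
  have [_ /(_ u) c] := ddf v; by move/cvgrPdist_lt : (c x Ux) => /(_ _ e20).
have cv : \forall y \near x, `|b - 'D_v (fun z => 'D_u f z) y| < e / 2.
  have [_ /(_ v) c] := ddf u; by move/cvgrPdist_lt : (c x Ux) => /(_ _ e20).
have nU := open_nbhs_nbhs (conj oU Ux).
have [d d0 Hd] := second_difference (u := v) u (filterI nU cu)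
  (fun y Uy => df y Uy.1) (fun y Uy => (ddf v).1 y Uy.1).
have [d' d'0 Hd'] := second_difference (u := u) v (filterI nU cv)
  (fun y Uy => df y Uy.1) (fun y Uy => (ddf u).1 y Uy.1).
pose h := Num.min d d' / 2.
have m0 : 0 < Num.min d d' by rewrite lt_min d0.
have h0 : 0 < h by rewrite divr_gt0.
have hm : h < Num.min d d' by rewrite ltr_pdivrMr// ltr_pMr// ltr1n.
move: hm; rewrite lt_min => /andP[hd hd'].
clearbody h.
have hn : h != 0 by rewrite gt_eqF.
have [y [_ ya] Ey] := Hd h h0 hd.
have [z [_ zb] Ez] := Hd' h h0 hd'.
clearbody a b.
move: ('D_u _ y) ('D_v _ z) ya zb Ey Ez => A B ya zb Ey Ez.
have E : A = B.
  apply/(mulIf hn)/(mulIf hn); rewrite -Ey -Ez (addrAC x).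
  by rewrite !opprB addrACA [in RHS]addrACA; congr (_ + _); rewrite addrC.
rewrite E in ya.
have -> : a - b = (a - B) + (B - b) by rewrite addrA subrK.
apply: le_trans (ler_normD _ _) _.
rewrite (splitr e); apply: lerD; apply: ltW; first exact: ya.
by rewrite distrC; exact: zb.
Qed.

Lemma schwarz m n (U : set V) (f : V -> 'M[R]_(m, n)) x u v :
  open U -> U x -> Ck 2 U f ->
  'D_u (fun y => 'D_v f y) x = 'D_v (fun y => 'D_u f y) x.
Proof.
move=> oU Ux Cf; have [df ddf] := Cf.
apply/matrixP => i j.
have cij : continuous (fun N : 'M[R]_(m, n) =>
  N i j) by exact: coord_continuous.
rewrite [LHS]deriv_mxE; last exact: (ddf v).1.
rewrite [RHS]deriv_mxE; last exact: (ddf u).1.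
have E w w' : 'D_w (fun y => ('D_w' f y) i j) x =
    'D_w (fun y => 'D_w' (fun z => f z i j) y) x.
  apply: near_eq_derive; apply: open_near_eq Ux _ => // y Uy.
  by rewrite deriv_mxE//; exact: df.
rewrite !E; apply: schwarz_scalar Ux _ => //.
split=> [y Uy|w]; first by have /differentiable_mxP := df _ Uy; exact.
apply: (@Ck_ext _ _ _ _ _ (fun y => ('D_w f y) i j)) => //.
  by move=> y Uy; rewrite deriv_mxE//; exact: df.
have [d1 d2] := ddf w; split=> [y Uy|w'].
  by have /differentiable_mxP := d1 _ Uy; exact.
move=> y Uy.
have H : {near y, (fun y => ('D_w' (fun y => 'D_w f y) y) i j) =1
                  (fun y => 'D_w' (fun y => ('D_w f y) i j) y)}.
  by apply: open_near_eq Uy _ => // z Uz; rewrite deriv_mxE//; exact: d1.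
rewrite /prop_for /continuous_at -(nbhs_singleton H).
apply: cvg_trans (near_eq_cvg H) _.
have c2 := d2 w' y Uy.
have cc := @coord_continuous R m n i j ('D_w' (fun y => 'D_w f y) y).
exact: (continuous_comp c2 cc).
Qed.

End Schwarz.

(** * Derivatives along a moving direction *)

Section Frames.
Context {R : realType}.

(** Finite dimensionality, in the form in which the derivative of [f] along a
    variable vector [v] becomes a combination of finitely many fixed partial
    derivatives, with coefficients that depend continuously on [v]. *)
Definition has_finite_frame (V : normedModType R) :=
  exists (I : finType) (l : I -> {linear V -> R}) (e : I -> V),
    (forall i, continuous (l i)) /\ forall v, v = \sum_i l i v *: e i.

Definition mxcoord m n i j (A : 'M[R]_(m, n)) : R := A i j.

Fact mxcoord_is_linear m n i j : linear (@mxcoord m n i j).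
Proof. by move=> a A B; rewrite /mxcoord !mxE. Qed.
HB.instance Definition _ m n i j := GRing.isLinear.Build R 'M[R]_(m, n) R _
  (@mxcoord m n i j) (@mxcoord_is_linear m n i j).

Lemma finite_frame_mx m n : has_finite_frame 'M[R]_(m, n).
Proof.
exists ('I_m * 'I_n)%type, (fun p => @mxcoord m n p.1 p.2),
  (fun p => delta_mx p.1 p.2).
split=> [p|A]; first exact: coord_continuous.
by rewrite [LHS]matrix_sum_delta pair_bigA.
Qed.

Lemma finite_frame_prod (V W : normedModType R) :
  has_finite_frame V -> has_finite_frame W -> has_finite_frame (V * W)%type.
Proof.
move=> [I [l [e [cl le]]]] [J [k [f [ck kf]]]].
exists (I + J)%type,
  (fun s => match s with
   | inl i => (l i \o fst : {linear (V * W)%type -> R})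
   | inr j => (k j \o snd : {linear (V * W)%type -> R}) end),
  (fun s => match s with inl i => (e i, 0) | inr j => (0, f j) end).
split=> [[i|j] p|[v w]].
- by apply: continuous_comp; [exact: continuous_fst|exact: cl].
- by apply: continuous_comp; [exact: continuous_snd|exact: ck].
rewrite big_sumType/=; apply/eqP; rewrite -pair_eqE/=; apply/andP; split;
  apply/eqP.
  rewrite !(raddf_sum fst, raddf_sum snd)/= [X in _ + X]big1 ?addr0; last first.
    by move=> j _; rewrite /= scaler0.
  exact: le.
rewrite !(raddf_sum fst, raddf_sum snd)/= [X in X + _]big1 ?add0r; last first.
  by move=> j _; rewrite /= scaler0.
exact: kf.
Qed.

(** Where the moving vector vanishes, only its own derivative contributes to the
    derivative of [f] along it: the other term of the product rule, which
    contains second derivatives of [f], is zero. *)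
Lemma derive_moving (T V W : normedModType R) (O : set V) (f : V -> W)
    (c Y : T -> V) x : has_finite_frame V -> open O -> smooth_on O f ->
  differentiable c x -> differentiable Y x -> O (c x) ->
  differentiable (fun r => 'D_(Y r) f (c r)) x /\
  (Y x = 0 -> forall v,
    'D_v (fun r => 'D_(Y r) f (c r)) x = 'D_('D_v Y x) f (c x)).
Proof.
move=> [I [l [e [cl le]]]] oO sf dc dY Oc.
have E : {near x, (fun r => \sum_i l i (Y r) *: 'D_(e i) f (c r)) =1
                  (fun r => 'D_(Y r) f (c r))}.
  have nO := open_nbhs_nbhs (conj oO Oc).
  have cO : nbhs x (c @^-1` O) := differentiable_continuous dc nO.
  apply: filterS cO => r Or.
  rewrite [X in _ = 'D_X f _]le derive_suml//;
    exact: smooth_differentiable sf Or.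
have dl i : differentiable (fun r => l i (Y r)) x.
  apply: (@differentiable_comp _ _ _ _ Y (l i)) => //.
  exact: linear_differentiable.
have df i : differentiable (fun r => 'D_(e i) f (c r)) x.
  apply: (@differentiable_comp _ _ _ _ c (fun y => 'D_(e i) f y)) => //.
  exact: smooth_differentiable (smooth_derive (e i) sf) Oc.
split.
  apply: near_eq_differentiable E _; apply: differentiable_big_sum => i.
  exact: differentiable_scale.
move=> Y0 v; rewrite -(near_eq_derive v E) derive_big_sum; last first.
  by move=> i; exact: differentiable_scale.
rewrite [in RHS](le ('D_v Y x)) derive_suml;
  last exact: smooth_differentiable sf Oc.
apply: eq_bigr => i _; rewrite derive_scale// Y0 linear0 scale0r addr0.
by rewrite [X in X *: _](derive_comp_lin _ (cl i) dY).
Qed.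

End Frames.

(** * The covariant derivative at a zero of the field *)

Lemma christoffel0r (R : realType) n (G : 'cV[R]_n -> 'M[R]_n) x v :
  christoffel G x v 0 = 0.
Proof.
rewrite /christoffel (_ : \col_l _ = 0) ?mulmx0//.
apply/matrixP => i j; rewrite !mxE derive0 /bil.
by rewrite trmx0 !(mul0mx, mulmx0) !mxE addr0 subr0 mulr0.
Qed.

Section TwCov.
Context (R : realType) (n : nat) (N : manifold R n.*2) (g : riem_metric N)
  (o : orientation N).

(** In a parametrization of the twistor space the field has components [s], and
    [s 0 = 0] removes the Christoffel term from the covariant derivative.  The
    differential of the parametrization is injective, so [s] has derivative 0;
    so has [Y], which depends linearly on [s]. *)
Lemma tw_cov_deriv_eq0 (j : midx N) (c Y : R -> EndCoord R n.*2) :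
  differentiable c 0 -> differentiable Y 0 -> Y 0 = 0 ->
  tw_cov_deriv g o j c Y 0 0 -> 'D_1 Y 0 = 0.
Proof.
move=> dc dY Y0 [d [U [k [B [rho [u [s [lp near_us W0]]]]]]]].
have [oU oO sk srho [img rhoK]] := lp.
have [Uu0 cku0 _] := nbhs_singleton near_us.
have kO v : U v -> B (k v).
  move=> Uv; have : (k @` U) (k v) by exists v.
  by rewrite img => -[].
have O0 : B (c 0) by rewrite cku0; exact: kO.
have dk v : U v -> differentiable k v by exact: smooth_differentiable.
have drho z : B z -> differentiable rho z by exact: smooth_differentiable.
(* rho is a left inverse of k, so the differential of rho recovers the
   components of a vector tangent to the image of k *)
have inv v w : U v -> 'D_('D_w k v) rho (k v) = w.
  move=> Uv; rewrite -derive_comp; [|exact: dk|exact/drho/kO].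
  rewrite (@near_eq_derive _ _ _ _ id); first exact: derive_id.
  exact: open_near_eq Uv rhoK.
have fE : has_finite_frame (EndCoord R n.*2).
  by apply: finite_frame_prod; exact: finite_frame_mx.
have Es : {near 0, (fun r => 'D_(Y r) rho (c r)) =1 s}.
  by apply: filterS near_us => r [Ur cr Yr] /=; rewrite cr Yr inv.
have Eu : {near 0, rho \o c =1 u}.
  by apply: filterS near_us => r [Ur cr _] /=; rewrite cr rhoK.
have du : differentiable u 0.
  by apply: near_eq_differentiable Eu _; apply: differentiable_comp => //;
    exact: drho.
have [ds' Ds'] := derive_moving fE oO srho dc dY O0.
have ds : differentiable s 0 := near_eq_differentiable Es ds'.
have s0 : s 0 = 0 by rewrite -(nbhs_singleton Es) Y0 derive0.
have Ds0 : 'D_1 s 0 = 0.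
  move: W0; rewrite /cov_deriv s0 christoffel0r addr0 derive1E => W0.
  by rewrite -(inv (u 0) ('D_1 s 0) Uu0) -W0 derive0.
have EY : {near 0, (fun r => 'D_(s r) k (u r)) =1 Y}.
  by apply: filterS near_us => r [_ _ Yr]; exact: esym Yr.
have [_ DY] := derive_moving (@finite_frame_mx R d 1) oU sk du ds Uu0.
rewrite -(near_eq_derive _ EY) (DY s0 1) Ds0; exact: derive0.
Qed.

End TwCov.

(** * Christoffel symbols *)

Section InverseMatrix.
Context {R : realType} {V : normedModType R}.

Lemma differentiable_big_prod (I : finType) (f : I -> V -> R) x :
  (forall i, differentiable (f i) x) ->
  differentiable (fun y => \prod_i f i y) x.
Proof.
move=> df; elim: (index_enum I) => [|i s IH].
  under eq_fun do rewrite big_nil; exact: (differentiable_cst (1 : R)).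
under eq_fun do rewrite big_cons; exact: (differentiableM (df i) IH).
Qed.

Lemma differentiable_det m (f : V -> 'M[R]_m) x :
  differentiable f x -> differentiable (fun y => \det (f y)) x.
Proof.
move=> /differentiable_mxP df; rewrite /determinant.
apply: differentiable_big_sum => s.
have ds : differentiable (fun y => \prod_i f y i (perm.fun_of_perm s i)) x.
  by apply: differentiable_big_prod => i; exact: df.
exact: (differentiableM (differentiable_cst (_ : R) x) ds).
Qed.

Lemma differentiable_adj m (f : V -> 'M[R]_m) x :
  differentiable f x -> differentiable (fun y => \adj (f y)) x.
Proof.
move=> /differentiable_mxP df; apply/differentiable_mxP => i j.
under eq_fun do rewrite mxE /cofactor.
have dd : differentiable (fun y => \det (row' j (col' i (f y)))) x.
  apply: differentiable_det; apply/differentiable_mxP => a b.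
  by under eq_fun do rewrite !mxE; exact: df.
exact: (differentiableM (differentiable_cst ((-1) ^+ (j + i) : R) x) dd).
Qed.

Lemma differentiable_invmx m (U : set V) (f : V -> 'M[R]_m) x :
  open U -> U x -> (forall y, U y -> f y \in unitmx) ->
  differentiable f x -> differentiable (fun y => invmx (f y)) x.
Proof.
move=> oU Ux fU df.
apply: (@near_eq_differentiable _ _ _ (fun y => (\det (f y))^-1 *: \adj (f y))).
  by apply: open_near_eq Ux _ => // y Uy; rewrite /invmx fU.
apply: differentiable_scale; last exact: differentiable_adj.
apply: differentiableV; first exact: differentiable_det.
by rewrite -unitfE -unitmxE fU.
Qed.

End InverseMatrix.

Section Christoffel.
Context {R : realType} {m : nat}.
Implicit Types (G : 'cV[R]_m -> 'M[R]_m) (x v w : 'cV[R]_m).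

Lemma bil_sym (B : 'M[R]_m) v w : B^T = B -> bil B v w = bil B w v.
Proof.
move=> sB; rewrite /bil -[in LHS]sB.
have -> : v^T *m B^T *m w = (w^T *m B *m v)^T by rewrite !trmx_mul trmxK mulmxA.
by rewrite mxE.
Qed.

Lemma derive_sym G x v : (forall y, (G y)^T = G y) -> differentiable G x ->
  ('D_v G x)^T = 'D_v G x.
Proof.
move=> sG dG; apply/matrixP => i j; rewrite mxE !deriv_mxE//.
by congr ('D_v _ x); apply/funext => y; rewrite -[in LHS]sG mxE.
Qed.

(** The Christoffel symbol with lowered index, with the derivatives of the
    metric along [v], [w] and the l-th basis vector replaced by arbitrary
    matrices [Bv], [Bw] and [B l]. *)
Definition koszul (Bv Bw : 'M[R]_m) (B : 'I_m -> 'M[R]_m) v w : 'cV[R]_m :=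
  \col_l (2^-1 * (bil Bv w (basisv l) + bil Bw v (basisv l) - bil (B l) v w)).

Lemma christoffelE G x v w : christoffel G x v w =
  invmx (G x) *m koszul ('D_v G x) ('D_w G x) (fun l => 'D_(basisv l) G x) v w.
Proof. by []. Qed.

Lemma koszul_sym (Bv Bw : 'M[R]_m) (B : 'I_m -> 'M[R]_m) v w :
  (forall l, (B l)^T = B l) -> koszul Bv Bw B v w = koszul Bw Bv B w v.
Proof.
move=> sB; apply/colP => l; rewrite !mxE (bil_sym v w (sB l)).
by rewrite (addrC (bil Bv _ _)).
Qed.

Lemma christoffel_sym G x v w : (forall y, (G y)^T = G y) ->
  differentiable G x -> christoffel G x v w = christoffel G x w v.
Proof.
move=> sG dG; rewrite !christoffelE koszul_sym// => l; exact: derive_sym.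
Qed.

Lemma bil_linearr (B : 'M[R]_m) v (k : R) w w' :
  bil B v (k *: w + w') = k * bil B v w + bil B v w'.
Proof. by rewrite /bil mulmxDr -scalemxAr [LHS]mxE [X in X + _]mxE. Qed.

Lemma bil_linearl (B : 'M[R]_m) v (k : R) w w' :
  bil B (k *: w + w') v = k * bil B w v + bil B w' v.
Proof.
rewrite /bil linearD linearZ/= !mulmxDl -!scalemxAl.
by rewrite [LHS]mxE [X in X + _]mxE.
Qed.

Lemma bil_linear_mx (B B' : 'M[R]_m) v (k : R) w :
  bil (k *: B + B') v w = k * bil B v w + bil B' v w.
Proof.
rewrite /bil mulmxDr mulmxDl -scalemxAr -scalemxAl.
by rewrite [LHS]mxE [X in X + _]mxE.
Qed.

Fact combine_three (h k a a' b b' c c' : R) :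
  h * (k * a + a' + (k * b + b') - (k * c + c')) =
  k * (h * (a + b - c)) + h * (a' + b' - c').
Proof. ring. Qed.

Lemma koszul_linear (Bv Bw Bw' : 'M[R]_m) (B : 'I_m -> 'M[R]_m) v (k : R) w w' :
  koszul Bv (k *: Bw + Bw') B v (k *: w + w') =
  k *: koszul Bv Bw B v w + koszul Bv Bw' B v w'.
Proof.
apply/colP => l; rewrite !mxE bil_linearl bil_linearr bil_linear_mx.
exact: combine_three.
Qed.

Lemma christoffel_is_linear G x v : differentiable G x ->
  linear (christoffel G x v).
Proof.
move=> dG k w w'; rewrite !christoffelE deriveDl// deriveZl//.
by rewrite koszul_linear mulmxDr -scalemxAr.
Qed.

Lemma linear_expand (W : lmodType R) (f : 'cV[R]_m -> W) v : linear f ->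
  f v = \sum_a v a 0 *: f (basisv a).
Proof.
move=> lf; pose L : {linear 'cV[R]_m -> W} :=
  HB.pack f (GRing.isLinear.Build _ _ _ _ _ lf).
rewrite -[f]/(L : _ -> _) {1}(matrix_sum_delta v) linear_sum.
by apply: eq_bigr => i _; rewrite big_ord1 linearZ.
Qed.

Lemma christoffel_suml G x v w : differentiable G x ->
  christoffel G x v w = \sum_i w i 0 *: christoffel G x v (basisv i).
Proof.
by move=> dG; apply: linear_expand; exact: christoffel_is_linear.
Qed.

Lemma christoffel_mxE G x v w : differentiable G x ->
  christoffel_mx G x v *m w = christoffel G x v w.
Proof.
move=> dG; rewrite [RHS]christoffel_suml//; apply/matrixP => i z.
rewrite !mxE summxE; apply: eq_bigr => l _.
by rewrite [in RHS]mxE mxE (ord1 z) mulrC.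
Qed.

Fact lin_entry p q (k : R) (A B : 'M[R]_(p, q)) i j :
  (k *: A + B) i j = k * A i j + B i j.
Proof. by rewrite !mxE. Qed.

Lemma christoffel_mx_is_linear G x : (forall y, (G y)^T = G y) ->
  differentiable G x -> linear (christoffel_mx G x).
Proof.
move=> sG dG k v v'; apply/matrixP => i l;
  rewrite lin_entry ![christoffel_mx _ _ _ _ _]mxE.
by rewrite !(@christoffel_sym _ _ _
  (basisv l))// christoffel_is_linear// lin_entry.
Qed.

Lemma christoffel_mx_suml G x v : (forall y, (G y)^T = G y) ->
  differentiable G x ->
  christoffel_mx G x v = \sum_a v a 0 *: christoffel_mx G x (basisv a).
Proof.
by move=> sG dG; apply: linear_expand; exact: christoffel_mx_is_linear.
Qed.

Lemma differentiable_christoffel_mx (U : set 'cV[R]_m) G x v :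
  open U -> U x -> smooth_on U G -> (forall y, U y -> G y \in unitmx) ->
  differentiable (fun y => christoffel_mx G y v) x.
Proof.
move=> oU Ux sG uG; apply/differentiable_mxP => k l.
under eq_fun do rewrite mxE.
move: k (0 : 'I_1); apply/differentiable_mxP; apply: differentiable_mulmx.
  exact: (differentiable_invmx oU Ux uG (smooth_differentiable sG Ux)).
have dbil a b c : differentiable (fun y => bil ('D_a G y) b c) x.
  rewrite /bil; move: (0 : 'I_1) {2}(0 : 'I_1); apply/differentiable_mxP.
  apply: differentiable_mulmx; last exact: differentiable_cst.
  apply: differentiable_mulmx; first exact: differentiable_cst.
  exact: smooth_differentiable (smooth_derive a sG) Ux.
apply/differentiable_mxP => i j; under eq_fun do rewrite mxE.
have d2 := differentiable_cst (2^-1 : R) x.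
apply: (differentiableM d2).
exact: (differentiableB (differentiableD (dbil _ _ _) (dbil _ _ _))
  (dbil _ _ _)).
Qed.

Lemma differentiable_christoffel_mx_moving (T : normedModType R)
    (U : set 'cV[R]_m) G (c v : T -> 'cV[R]_m) t :
  open U -> smooth_on U G -> (forall y, U y -> G y \in unitmx) ->
  (forall y, (G y)^T = G y) -> U (c t) -> differentiable c t ->
  differentiable v t ->
  differentiable (fun r => christoffel_mx G (c r) (v r)) t.
Proof.
move=> oU sG uG symG Uc dc dv.
apply: (@near_eq_differentiable _ _ _ (fun r =>
    \sum_a v r a 0 *: christoffel_mx G (c r) (basisv a))).
  have nU := open_nbhs_nbhs (conj oU Uc).
  have cU : nbhs t (c @^-1` U) := differentiable_continuous dc nU.
  apply: filterS cU => r Ur.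
  by rewrite [RHS]christoffel_mx_suml//; exact: smooth_differentiable sG Ur.
apply: differentiable_big_sum => a; apply: differentiable_scale.
  by have /differentiable_mxP := dv; exact.
apply: (@differentiable_comp _ _ _ _ c (fun y =>
  christoffel_mx G y (basisv a))) => //.
exact: differentiable_christoffel_mx Uc sG uG.
Qed.

End Christoffel.

(** * The pointwise identity *)

Section Identity.
Context {R : realType} {m : nat}.

(** The identity behind the theorem, for the jets at one point: [C0] and [C1]
    are the connection matrices along the two directions, [V0] is the covariant
    derivative of [A] along the first, [a0] and [a1] are the two horizontal
    defects.  [C1] is split as the connection matrices [CA] of [A *m f0] and
    [Ca] of [a0], because [f1] is the sum of these two vectors. *)
Lemma twistor_identity (f0 f1 f00 f01 f11 : 'cV[R]_m)
  (A A0 A1 C0 C1 CA Ca : 'M[R]_m) :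
  let V0 := A0 + (C0 *m A - A *m C0) in
  let a0 := f1 - A *m f0 in
  let a1 := - f0 - A *m f1 in
  A *m A = - 1%:M -> A0 *m A + A *m A0 = 0 -> C0 *m f1 = C1 *m f0 ->
  CA + Ca = C1 ->
  f00 + C0 *m f0 + (f11 + C1 *m f1) =
    (A1 + (CA *m A - A *m CA) + A *m V0 + (Ca *m A - A *m Ca)) *m f0
    - V0 *m a0 + (f11 - (A1 *m f0 + A *m f01) + C1 *m a0)
    - (- f00 - (A0 *m f1 + A *m f01) + C0 *m a1).
Proof.
move=> V0 a0 a1 AA AA0 symC CAa.
have -> : A1 + (CA *m A - A *m CA) + A *m V0 + (Ca *m A - A *m Ca) =
    A1 + (C1 *m A - A *m C1) + A *m V0.
  have <- : CA *m A - A *m CA + (Ca *m A - A *m Ca) = C1 *m A - A *m C1.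
    by rewrite -CAa mulmxDl mulmxDr opprD addrACA.
  move: (CA *m A - A *m CA) (A *m V0) (Ca *m A - A *m Ca) => X Y Z.
  by rewrite addrAC addrA.
have AAv (v : 'cV[R]_m) :
  A *m (A *m v) = - v by rewrite mulmxA AA mulNmx mul1mx.
have AA0v (v : 'cV[R]_m) : A0 *m (A *m v) = - (A *m (A0 *m v)).
  by apply/eqP; rewrite -addr_eq0 !mulmxA -mulmxDl AA0 mul0mx.
rewrite /V0 /a0 /a1.
rewrite !(mulmxDl, mulmxDr, mulmxBl, mulmxBr, mulmxN, mulNmx) -!mulmxA.
rewrite !(AAv, AA0v, symC, mulmxN).
(* what remains is an identity of abelian groups between monomials *)
move: (A *m (A0 *m f0)) (A *m (C0 *m (A *m f0))) (C1 *m (A *m f0)) => v1 v2 v3.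
move: (A *m (C1 *m f0)) (A1 *m f0) (A0 *m f1) (C0 *m (A *m f1)) => v4 v5 v6 v7.
move: (A *m f01) (C1 *m f1) (C0 *m f0) => v8 v9 v10.
apply/colP => k; rewrite !mxE.
ring.
Qed.

End Identity.

(** * Vanishing to first order *)

Section Flat.
Context {R : realType} {V : normedModType R}.

(** [h] vanishes at [z] to first order in the direction [T]; [T] is the time
    direction in what follows. *)
Definition flat (W : normedModType R) (T : V) (h : V -> W) (z : V) :=
  [/\ differentiable h z, h z = 0 & 'D_T h z = 0].

Lemma flat_ext (W : normedModType R) (O : set V) T (h k : V -> W) z :
  open O -> O z -> (forall y, O y -> h y = k y) -> flat T h z -> flat T k z.
Proof.
move=> oO Oz hk [dh h0 Dh]; have E := open_near_eq oO Oz hk.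
split; first exact: near_eq_differentiable E dh.
  by rewrite -hk.
by rewrite -(near_eq_derive _ E).
Qed.

Lemma flatD (W : normedModType R) T (h k : V -> W) z :
  flat T h z -> flat T k z -> flat T (fun y => h y + k y) z.
Proof.
move=> [dh h0 Dh] [dk k0 Dk]; split; first exact: differentiableD.
  by rewrite h0 k0 addr0.
rewrite [LHS](@deriveD _ _ _ h k); do ?exact: diff_derivable.
by rewrite Dh Dk addr0.
Qed.

Lemma flatB (W : normedModType R) T (h k : V -> W) z :
  flat T h z -> flat T k z -> flat T (fun y => h y - k y) z.
Proof.
move=> [dh h0 Dh] [dk k0 Dk]; split; first exact: differentiableB.
  by rewrite h0 k0 subr0.
rewrite [LHS](@deriveB _ _ _ h k); do ?exact: diff_derivable.
by rewrite Dh Dk subr0.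
Qed.

Lemma flat_mull m n p T (h : V -> 'M[R]_(m, n)) (k : V -> 'M[R]_(n, p)) z :
  flat T h z -> differentiable k z -> flat T (fun y => h y *m k y) z.
Proof.
move=> [dh h0 Dh] dk; split; first exact: differentiable_mulmx.
  by rewrite h0 mul0mx.
by rewrite derive_mulmx// Dh h0 !mul0mx addr0.
Qed.

Lemma flat_mulr m n p T (h : V -> 'M[R]_(m, n)) (k : V -> 'M[R]_(n, p)) z :
  differentiable h z -> flat T k z -> flat T (fun y => h y *m k y) z.
Proof.
move=> dh [dk k0 Dk]; split; first exact: differentiable_mulmx.
  by rewrite k0 mulmx0.
by rewrite derive_mulmx// Dk k0 !mulmx0 addr0.
Qed.

Lemma flat_scale (W : normedModType R) T (h : V -> R) (k : V -> W) z :
  flat T h z -> differentiable k z -> flat T (fun y => h y *: k y) z.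
Proof.
move=> [dh h0 Dh] dk; split; first exact: differentiable_scale.
  by rewrite h0 scale0r.
by rewrite derive_scale// Dh h0 !scale0r addr0.
Qed.

Lemma flat_sum (W : normedModType R) (I : finType) T (h : I -> V -> W) z :
  (forall i, flat T (h i) z) -> flat T (fun y => \sum_i h i y) z.
Proof.
move=> fh; split.
- by apply: differentiable_big_sum => i; have [] := fh i.
- by rewrite big1// => i _; have [] := fh i.
- rewrite derive_big_sum; last by move=> i; have [] := fh i.
  by rewrite big1// => i _; have [] := fh i.
Qed.

Lemma flat_coord m n T (h : V -> 'M[R]_(m, n)) z i j :
  flat T h z -> flat T (fun y => h y i j) z.
Proof.
move=> [dh h0 Dh]; split; first by move/differentiable_mxP : dh; exact.
  by rewrite h0 mxE.
by rewrite -deriv_mxE// Dh mxE.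
Qed.

End Flat.

(** * Maps into the twistor space in coordinates *)

Section MovingFrame.
Context {R : realType} {V : normedModType R} {m : nat}.
Variables (U : set 'cV[R]_m) (G : 'cV[R]_m -> 'M[R]_m).
Hypotheses (oU : open U) (sG : smooth_on U G)
  (uG : forall y, U y -> G y \in unitmx) (symG : forall y, (G y)^T = G y).
Variables (O : set V) (f : V -> 'cV[R]_m) (A : V -> 'M[R]_m).
Hypotheses (oO : open O) (sf : smooth_on O f) (sA : smooth_on O A)
  (fU : forall z, O z -> U (f z)).

(** The covariant derivative of [A], as a section of the endomorphism bundle
    along [f]. *)
Definition cov_end e z : 'M[R]_m :=
  'D_e A z + (christoffel_mx G (f z) ('D_e f z) *m A z
              - A z *m christoffel_mx G (f z) ('D_e f z)).

(** The two components, in the coordinates of the endomorphism bundle, of the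
    defect of J^2-holomorphy in a direction [e] whose image under J is [e'].
    The second one is not the vertical part of the defect: this is
    [fibre_defect] plus the commutator of the connection matrix of
    [base_defect] with [A]. *)
Definition base_defect e e' z : 'cV[R]_m := 'D_e' f z - A z *m 'D_e f z.

Definition fibre_defect e e' z : 'M[R]_m :=
  let C := christoffel_mx G (f z) (A z *m 'D_e f z) in
  'D_e' A z + (C *m A z - A z *m C) + A z *m cov_end e z.

(** The covariant derivative of a section of the tangent bundle of the target
    along [f]. *)
Definition cov_base e (s : V -> 'cV[R]_m) z : 'cV[R]_m :=
  'D_e s z + christoffel_mx G (f z) ('D_e f z) *m s z.

Let dG z : O z -> differentiable G (f z).
Proof. by move=> Oz; exact: smooth_differentiable sG (fU Oz). Qed.

Let df z : O z -> differentiable f z.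
Proof. by move=> Oz; exact: smooth_differentiable sf Oz. Qed.

Let dA z : O z -> differentiable A z.
Proof. by move=> Oz; exact: smooth_differentiable sA Oz. Qed.

Let dDf e z : O z -> differentiable (fun y => 'D_e f y) z.
Proof. by move=> Oz; exact: smooth_differentiable (smooth_derive e sf) Oz. Qed.

Let dDA e z : O z -> differentiable (fun y => 'D_e A y) z.
Proof. by move=> Oz; exact: smooth_differentiable (smooth_derive e sA) Oz. Qed.

Let dC (v : V -> 'cV[R]_m) z : O z -> differentiable v z ->
  differentiable (fun y => christoffel_mx G (f y) (v y)) z.
Proof.
move=> Oz dv.
exact: differentiable_christoffel_mx_moving oU sG uG symG (fU Oz) (df Oz) dv.
Qed.

Lemma smooth_base_defect e e' : smooth_on O (base_defect e e').
Proof.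
move=> k.
exact: (CkB oO (smooth_derive e' sf k) (Ck_mulmx oO (sA k)
  (smooth_derive e sf k))).
Qed.

Lemma differentiable_cov_end e z : O z -> differentiable (cov_end e) z.
Proof.
move=> Oz; apply: differentiableD; first exact: dDA.
have dAz := dA Oz; have dCz := dC Oz (dDf e Oz).
apply: differentiableB; first exact: (differentiable_mulmx dCz dAz).
exact: (differentiable_mulmx dAz dCz).
Qed.

Lemma differentiable_fibre_defect e e' z :
  O z -> differentiable (fibre_defect e e') z.
Proof.
move=> Oz; have dCA : differentiable
    (fun y => christoffel_mx G (f y) (A y *m 'D_e f y)) z.
  exact: (dC Oz (differentiable_mulmx (dA Oz) (dDf e Oz))).
have dAz := dA Oz.
apply: differentiableD; last first.
  exact: (differentiable_mulmx dAz (differentiable_cov_end e Oz)).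
apply: differentiableD; first exact: dDA.
apply: differentiableB; first exact: (differentiable_mulmx dCA dAz).
exact: (differentiable_mulmx dAz dCA).
Qed.

Lemma flat_christoffel_mx T (v : V -> 'cV[R]_m) z : O z -> flat T v z ->
  flat T (fun y => christoffel_mx G (f y) (v y)) z.
Proof.
move=> Oz fv.
apply: (flat_ext (h := fun y =>
  \sum_a v y a 0 *: christoffel_mx G (f y) (basisv a)) oO Oz).
  by move=> y Oy; rewrite [RHS]christoffel_mx_suml//; exact: dG.
apply: flat_sum => a; apply: flat_scale; first exact: flat_coord.
by apply: (dC (v := cst (basisv a))) => //; exact: differentiable_cst.
Qed.

Hypothesis sqA : forall z, O z -> A z *m A z = - 1%:M.

Lemma derive_sq e z : O z -> 'D_e A z *m A z + A z *m 'D_e A z = 0.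
Proof.
move=> Oz; have dAz := dA Oz; rewrite -derive_mulmx//.
rewrite (@near_eq_derive _ _ _ _ (cst (- 1%:M))); first exact: derive_cst.
exact: open_near_eq Oz sqA.
Qed.

Variables (e0 e1 : V).

(** The tension field of [f] for the flat metric on the plane spanned by [e0]
    and [e1]. *)
Definition euclidean_tension z : 'cV[R]_m :=
  cov_base e0 (fun y => 'D_e0 f y) z + cov_base e1 (fun y => 'D_e1 f y) z.

(** In the intended use [e1] is the image of [e0] under J, so that the image of
    [e1] is [- e0]. *)
Lemma euclidean_tensionE z : O z -> euclidean_tension z =
  (fibre_defect e0 e1 z
    + (christoffel_mx G (f z) (base_defect e0 e1 z) *m A z
       - A z *m christoffel_mx G (f z) (base_defect e0 e1 z))) *m 'D_e0 f z
  - cov_end e0 z *m base_defect e0 e1 z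
  + cov_base e1 (base_defect e0 e1) z - cov_base e0 (base_defect e1 (- e0)) z.
Proof.
move=> Oz; have dGz := dG Oz; have dfz := df Oz; have dAz := dA Oz.
have D1 : 'D_e1 (base_defect e0 e1) z =
    'D_e1 (fun y => 'D_e1 f y) z
    - ('D_e1 A z *m 'D_e0 f z + A z *m 'D_e0 (fun y => 'D_e1 f y) z).
  rewrite [LHS](@deriveB _ _ _ (fun y => 'D_e1 f y) (fun y =>
    A y *m 'D_e0 f y));
    [|exact/diff_derivable/dDf
     |by apply: diff_derivable; apply: differentiable_mulmx => //; exact: dDf].
  rewrite (derive_mulmx e1 dAz (dDf e0 Oz)).
  have S := schwarz e1 e0 oO Oz (sf 2).
  exact: (congr1 (fun w => _ - (_ + A z *m w)) S).
have D0 : 'D_e0 (base_defect e1 (- e0)) z =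
    - 'D_e0 (fun y => 'D_e0 f y) z
    - ('D_e0 A z *m 'D_e1 f z + A z *m 'D_e0 (fun y => 'D_e1 f y) z).
  rewrite [LHS](@deriveB _ _ _ (fun y => 'D_(- e0) f y) (fun y =>
    A y *m 'D_e1 f y));
    [|exact/diff_derivable/dDf
     |by apply: diff_derivable; apply: differentiable_mulmx => //; exact: dDf].
  rewrite (derive_mulmx e0 dAz (dDf e1 Oz)).
  congr (_ - _); rewrite -[RHS](@deriveN _ _ _ (fun y => 'D_e0 f y));
    last exact/diff_derivable/dDf.
  apply: near_eq_derive; apply: open_near_eq Oz _ => // y Oy.
  by rewrite deriveNl//; exact: df.
have R1 : cov_base e1 (base_defect e0 e1) z = _ := congr1 (fun w => w +
  christoffel_mx G (f z) ('D_e1 f z) *m base_defect e0 e1 z) D1.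
have a1E : base_defect e1 (- e0) z = - 'D_e0 f z - A z *m 'D_e1 f z.
  by rewrite /base_defect deriveNl.
have R0 : cov_base e0 (base_defect e1 (- e0)) z = _ := congr1 (fun w => w +
  christoffel_mx G (f z) ('D_e0 f z) *m base_defect e1 (- e0) z) D0.
rewrite [in RHS]a1E in R0.
have symC : christoffel_mx G (f z) ('D_e0 f z) *m 'D_e1 f z =
            christoffel_mx G (f z) ('D_e1 f z) *m 'D_e0 f z.
  apply: etrans (christoffel_mxE _ _ dGz) _.
  by apply: etrans (christoffel_sym _ _ symG dGz) _;
    exact: (esym (christoffel_mxE _ _ dGz)).
have addC : christoffel_mx G (f z) (A z *m 'D_e0 f z) +
    christoffel_mx G (f z) (base_defect e0 e1 z) =
    christoffel_mx G (f z) ('D_e1 f z).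
  have L := christoffel_mx_is_linear symG dGz 1 (A z *m 'D_e0 f z)
    (base_defect e0 e1 z).
  rewrite !scale1r in L; rewrite -L; congr (christoffel_mx G (f z) _).
  by rewrite addrC; exact: subrK.
have H := @twistor_identity _ _ _ _ ('D_e0 (fun y => 'D_e0 f y) z)
  ('D_e0 (fun y => 'D_e1 f y) z) ('D_e1 (fun y => 'D_e1 f y) z)
  _ _ ('D_e1 A z) _ _ _ _ (sqA Oz) (derive_sq e0 Oz) symC addC.
move: (cov_base e1 (base_defect e0 e1) z) R1 => _ ->.
move: (cov_base e0 (base_defect e1 (- e0)) z) R0 => _ ->.
exact: H.
Qed.

(** Every term of [euclidean_tensionE] contains a factor that vanishes to first
    order. *)
Lemma flat_euclidean_tension T z : O z ->
  flat T (base_defect e0 e1) z -> flat T (base_defect e1 (- e0)) z ->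
  flat T (fibre_defect e0 e1) z ->
  flat T (fun y => 'D_e1 (base_defect e0 e1) y) z ->
  flat T (fun y => 'D_e0 (base_defect e1 (- e0)) y) z ->
  flat T euclidean_tension z.
Proof.
move=> Oz b01 b10 f01 d01 d10; have dAz := dA Oz.
have oE y : O y -> _ = euclidean_tension y := fun Oy =>
  esym (euclidean_tensionE Oy).
apply: (flat_ext oO Oz oE).
have fC := flat_christoffel_mx Oz b01.
have fib := flatD f01 (flatB (flat_mull fC dAz) (flat_mulr dAz fC)).
have dC1 := dC Oz (dDf e1 Oz); have dC0 := dC Oz (dDf e0 Oz).
have t1 := flat_mull fib (dDf e0 Oz).
have t2 := flat_mulr (differentiable_cov_end e0 Oz) b01.
have t3 := flatD d01 (flat_mulr dC1 b01).
have t4 := flatD d10 (flat_mulr dC0 b10).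
exact: (flatB (flatD (flatB t1 t2) t3) t4).
Qed.

End MovingFrame.

(** * Time slices *)

Section Slices.
Context {R : realType} {E : normedModType R}.
Local Notation Z := (R^o * E)%type.

(** The family is a function on the product of the time line and the surface;
    its derivatives along a factor are those of its restrictions to slices. *)
Lemma derive_slice (W : normedModType R) (h : Z -> W) (t : R) (x v : E) :
  'D_((0 : R^o), v) h (t, x) = 'D_v (fun y => h (t, y)) x.
Proof.
rewrite /derive; set g := (fun _ => _); set k := (fun _ => _).
suff -> : g = k by [].
apply/funext => r; rewrite /g /k /=.
have -> : r *: ((0 : R^o), v) + (t, x) = (t, r *: v + x) :> Z.
  by congr pair; rewrite /= scaler0 add0r.
by [].
Qed.

Lemma derive_time (W : normedModType R) (h : Z -> W) (t : R) (x : E) :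
  'D_((1 : R^o), (0 : E)) h (t, x) = 'D_1 (fun r : R => h (r, x)) t.
Proof.
rewrite /derive; set g := (fun _ => _); set k := (fun _ => _).
suff -> : g = k by [].
apply/funext => r; rewrite /g /k /=.
have -> : r *: ((1 : R^o), (0 : E)) + (t, x) = (r *: (1 : R) + t, x) :> Z.
  by congr pair; rewrite /= scaler0 add0r.
by [].
Qed.

Lemma differentiable_time (W : normedModType R) (h : Z -> W) (t : R) (x : E) :
  differentiable h (t, x) -> differentiable (fun r : R => h (r, x)) t.
Proof.
by move=> dh; apply: (@differentiable_comp _ _ _ _ (fun r : R =>
  ((r : R^o), x)) h).
Qed.

Lemma open_slice (O : set Z) (t : R) : open O -> open [set y | O (t, y)].
Proof.
move=> oO; rewrite (_ : mkset _ = (fun y : E => ((t : R^o), y)) @^-1` O)//.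
apply: open_comp => // y _.
have c1 : (t : R^o) @[_ --> y] --> (t : R^o) by exact: cvg_cst.
have c2 : z @[z --> y] --> y by exact: cvg_id.
exact: (cvg_pair c1 c2).
Qed.

Lemma derive_slice_eq0 (W : normedModType R) (O : set Z) (h : Z -> W) (t : R)
    (x v : E) : open O -> O (t, x) -> (forall y, O (t, y) -> h (t, y) = 0) ->
  'D_((0 : R^o), v) h (t, x) = 0.
Proof.
move=> oO Ox h0; rewrite derive_slice (@near_eq_derive _ _ _ _ (cst 0)).
  exact: derive_cst.
exact: (open_near_eq (open_slice t oO) (Ox : [set y | O (t, y)] x) h0).
Qed.

(** Mixed partial derivatives commute, and both the function and its time
    derivative are zero along the whole slice. *)
Lemma flat_derive_slice m n (O : set Z) (h : Z -> 'M[R]_(m, n)) (t : R)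
  (x v : E) :
  open O -> O (t, x) -> smooth_on O h ->
  (forall y, O (t, y) -> flat ((1 : R^o), (0 : E)) h (t, y)) ->
  flat ((1 : R^o), (0 : E)) (fun z => 'D_((0 : R^o), v) h z) (t, x).
Proof.
move=> oO Ox sh fh; split.
- exact: smooth_differentiable (smooth_derive _ sh) Ox.
- by apply: derive_slice_eq0 Ox _ => // y /fh[].
- rewrite (schwarz _ _ oO Ox (sh 2)).
  by apply: derive_slice_eq0 Ox _ => // y /fh[].
Qed.

End Slices.

(** * Local families of maps into the twistor space *)

Lemma derive_fst (R : realType) (V W W' : normedModType R)
  (F : V -> W * W') z v :
  differentiable F z -> ('D_v F z).1 = 'D_v (fst \o F) z.
Proof.
move=> dF; rewrite (derive_comp_lin (L := fst))//; exact: continuous_fst.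
Qed.

Lemma derive_snd (R : realType) (V W W' : normedModType R)
  (F : V -> W * W') z v :
  differentiable F z -> ('D_v F z).2 = 'D_v (snd \o F) z.
Proof.
move=> dF; rewrite (derive_comp_lin (L := snd))//; exact: continuous_snd.
Qed.

Lemma sub_J2E (R : realType) m (G : 'cV[R]_m -> 'M[R]_m)
    (z Y Y' : EndCoord R m) v v' B B' :
  Y.1 = v -> Y.2 = B -> Y'.1 = v' -> Y'.2 = B' ->
  Y' - J2 G z Y =
  (v' - z.2 *m v,
   B' + (christoffel_mx G z.1 (z.2 *m v) *m z.2
           - z.2 *m christoffel_mx G z.1 (z.2 *m v))
   + z.2 *m (B + (christoffel_mx G z.1 v *m z.2
                    - z.2 *m christoffel_mx G z.1 v))).
Proof.
case: z Y Y' => [x A] [w C] [w' C'] /= -> -> -> ->;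
  rewrite /J2 /vpart /hlift /=.
have E (a b : 'cV[R]_m) (c d e : 'M[R]_m) :
  (a, c) - ((b, d) + (0, e)) = (a - (b + 0), c - (d + e)) by [].
by rewrite E addr0 opprK opprD !opprK addrA.
Qed.

Section LocalFamily.
Context {R : realType} {m : nat}.
Local Notation Z := (R^o * 'cV[R]_2)%type.

Lemma J0_basis0 : (J0 : 'M[R]_2) *m basisv 0 = basisv 1.
Proof.
apply/colP => i; rewrite mxE !big_ord_recl big_ord0 !mxE/=.
by case: i => -[|[|]]//= ?; rewrite ?(mulr0, mulr1, addr0, mul0r, mul1r, add0r).
Qed.

Lemma J0_basis1 : (J0 : 'M[R]_2) *m basisv 1 = - basisv 0.
Proof.
apply/colP => i; rewrite mxE !big_ord_recl big_ord0 !mxE/=.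
by case: i => -[|[|]]//= ?;
  rewrite ?(mulr0, mulr1, addr0, mul0r, mul1r, add0r, oppr0).
Qed.

Variables (U : set 'cV[R]_m) (G : 'cV[R]_m -> 'M[R]_m).
Hypotheses (oU : open U) (sG : smooth_on U G)
  (uG : forall y, U y -> G y \in unitmx) (symG : forall y, (G y)^T = G y).
Variables (O : set Z) (F : Z -> EndCoord R m).
Hypotheses (oO : open O) (sF : smooth_on O F) (FU : forall z, O z -> U (F z).1)
  (sqF : forall z, O z -> (F z).2 *m (F z).2 = - 1%:M).

Let f : Z -> 'cV[R]_m := fst \o F.
Let A : Z -> 'M[R]_m := snd \o F.
Let dir (X : 'cV[R]_2) : Z := ((0 : R^o), X).

Lemma smooth_fst : smooth_on O f.
Proof. exact: (smooth_lin oO (L := fst) (@continuous_fst _ _ _) sF). Qed.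

Lemma smooth_snd : smooth_on O A.
Proof. exact: (smooth_lin oO (L := snd) (@continuous_snd _ _ _) sF). Qed.

Definition local_defect X z : EndCoord R m :=
  'D_(dir (J0 *m X)) F z - J2 G (F z) ('D_(dir X) F z).

Lemma local_defectE X z : O z -> local_defect X z =
  (base_defect f A (dir X) (dir (J0 *m X)) z,
   fibre_defect G f A (dir X) (dir (J0 *m X)) z).
Proof.
move=> Oz; have dF := smooth_differentiable sF Oz.
have H := sub_J2E G (F z) (derive_fst (dir X) dF) (derive_snd (dir X) dF)
  (derive_fst (dir (J0 *m X)) dF) (derive_snd (dir (J0 *m X)) dF).
exact: H.
Qed.

Lemma differentiable_local_defect X z :
  O z -> differentiable (local_defect X) z.
Proof.
move=> Oz.
have E : {near z, (fun z => (base_defect f A (dir X) (dir (J0 *m X)) z,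
   fibre_defect G f A (dir X) (dir (J0 *m X)) z)) =1 local_defect X}.
  by apply: open_near_eq Oz _ => // y Oy; rewrite local_defectE.
apply: near_eq_differentiable E _; apply: differentiable_pair.
  exact: (smooth_differentiable
    (smooth_base_defect oO smooth_fst smooth_snd _ _) Oz).
exact: (differentiable_fibre_defect oU sG uG symG smooth_fst smooth_snd FU).
Qed.

Let T : Z := ((1 : R^o), 0).

(** [euclidean_tensionE] along the slice at time 0.  The derivatives of the
    horizontal defects in it are treated by [flat_derive_slice], which needs the
    defect to vanish along the whole slice and not only at [x]. *)
Lemma flat_tension_of_flat_defect (x : 'cV[R]_2) :
  (forall y X, O (0, y) -> local_defect X (0, y) = 0) ->
  (forall y X, O (0, y) -> 'D_T (local_defect X) (0, y) = 0) ->
  O (0, x) ->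
  flat T (euclidean_tension G f (dir (basisv 0)) (dir (basisv 1))) (0, x).
Proof.
move=> d0 Dd0 Ox.
have sf := smooth_fst; have sA := smooth_snd.
have fdef y X : O (0, y) -> flat T (local_defect X) (0, y).
  move=> Oy; split; [exact: differentiable_local_defect|exact: d0|exact: Dd0].
have sb e e' : smooth_on O (base_defect f A e e') by exact: smooth_base_defect.
have fbase y X : O (0, y) -> flat T (base_defect f A (dir X) (dir (J0 *m X)))
  (0, y).
  move=> Oy; have [dd e0 De] := fdef y X Oy.
  apply: (flat_ext (h := fst \o local_defect X) oO Oy) => [z Oz|].
    exact: (congr1 fst (local_defectE X Oz)).
  split.
  - apply: differentiable_comp => //; apply: linear_differentiable.
    exact: continuous_fst.
  - exact: (congr1 fst e0).
  - by rewrite derive_comp_lin//; [rewrite De|exact: continuous_fst].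
have ffib y X : O (0, y) -> flat T (fibre_defect G f A (dir X)
  (dir (J0 *m X))) (0, y).
  move=> Oy; have [dd e0 De] := fdef y X Oy.
  apply: (flat_ext (h := snd \o local_defect X) oO Oy) => [z Oz|].
    exact: (congr1 snd (local_defectE X Oz)).
  split.
  - apply: differentiable_comp => //; apply: linear_differentiable.
    exact: continuous_snd.
  - exact: (congr1 snd e0).
  - by rewrite derive_comp_lin//; [rewrite De|exact: continuous_snd].
have dirN : dir (J0 *m basisv 1) = - dir (basisv 0).
  by rewrite J0_basis1; congr pair; rewrite /= oppr0.
have b01 y : O (0, y) ->
    flat T (base_defect f A (dir (basisv 0)) (dir (basisv 1))) (0, y).
  by move=> /(fbase y (basisv 0)); rewrite J0_basis0.
have b10 y : O (0, y) ->
    flat T (base_defect f A (dir (basisv 1)) (- dir (basisv 0))) (0, y).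
  by move=> /(fbase y (basisv 1)); rewrite dirN.
apply: (flat_euclidean_tension oU sG uG symG oO sf sA FU sqF Ox).
- exact: b01.
- exact: b10.
- by have := ffib x (basisv 0) Ox; rewrite J0_basis0.
- exact: (flat_derive_slice _ oO Ox (sb _ _) b01).
- exact: (flat_derive_slice _ oO Ox (sb _ _) b10).
Qed.

End LocalFamily.

(** * Charts and metrics *)

Section Jacobian.
Context {R : realType}.

Lemma bil_basis n (B : 'M[R]_n) a b : bil B (basisv a) (basisv b) = B a b.
Proof. by rewrite /bil trmx_delta -mulmxA -colE -rowE !mxE. Qed.

Lemma mul_jac m n (f : 'cV[R]_n -> 'cV[R]_m) x v : differentiable f x ->
  jac f x *m v = 'D_v f x.
Proof.
move=> df; rewrite [in RHS](matrix_sum_delta v).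
under [in RHS]eq_bigr do rewrite big_ord1.
rewrite derive_suml//; apply/colP => i; rewrite mxE summxE.
by apply: eq_bigr => j _; rewrite !mxE mulrC.
Qed.

Lemma jac_comp m n p (f : 'cV[R]_n -> 'cV[R]_m) (k : 'cV[R]_m -> 'cV[R]_p) x :
  differentiable f x -> differentiable k (f x) ->
  jac (k \o f) x = jac k (f x) *m jac f x.
Proof.
move=> df dk; apply/matrixP => i j.
rewrite [LHS]mxE derive_comp// -mul_jac// -mul_jac//.
by rewrite mulmxA -colE mxE.
Qed.

Lemma jac_near_id n (f : 'cV[R]_n -> 'cV[R]_n) x :
  {near x, f =1 id} -> jac f x = 1%:M.
Proof.
move=> fid; apply/matrixP => i j; rewrite mxE (near_eq_derive _ fid) derive_id.
by rewrite !mxE eqxx andbT.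
Qed.

End Jacobian.

Section Charts.
Context {R : realType} {n : nat} {M : manifold R n}.
Implicit Types (i j : midx M) (p : M) (x : 'cV[R]_n).

Lemma chart_img i p : mdom i p -> (mchart i @` mdom i) (mchart i p).
Proof. by move=> ip; exists p. Qed.

Lemma minv_dom i x : (mchart i @` mdom i) x -> mdom i (minv i x).
Proof. by move=> [q iq <-]; rewrite mchartK. Qed.

Lemma minvK i x : (mchart i @` mdom i) x -> mchart i (minv i x) = x.
Proof. by move=> [q iq <-]; rewrite mchartK. Qed.

Lemma transition_inverse i j p : mdom i p -> mdom j p ->
  jac (mchart i \o minv j) (mchart j p) *m
  jac (mchart j \o minv i) (mchart i p) = 1%:M.
Proof.
move=> ip jp.
have dt k l q : mdom k q -> mdom l q ->
    differentiable (mchart l \o minv k) (mchart k q).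
  by move=> kq lq; apply: smooth_differentiable (m_transition_smooth k l) _;
    exists q.
have E : (mchart j \o minv i) (mchart i p) = mchart j p by rewrite /= mchartK.
rewrite -[in X in X *m _]E -jac_comp ?E; [|exact: dt|exact: dt].
apply: jac_near_id.
have ci : nbhs (mchart i p) (minv i @^-1` mdom j).
  apply: (minv_continuous (chart_img ip)); rewrite mchartK//.
  exact: open_nbhs_nbhs (conj (m_open_dom j) jp).
have oi := open_nbhs_nbhs (conj (@m_open_img _ _ _ i) (chart_img ip)).
apply: filterS (filterI ci oi) => x [jx ix].
by rewrite /= mchartK//; exact: minvK.
Qed.

Lemma tcoord_unit i p : mdom i p -> tcoord i p \in unitmx.
Proof.
move=> ip; exact: (mulmx1_unit (transition_inverse ip (mat_dom p))).1.
Qed.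

Lemma metric_coord_sym (g : riem_metric M) i x :
  (metric_coord g i x)^T = metric_coord g i x.
Proof. by rewrite /metric_coord !trmx_mul trmxK rm_sym mulmxA. Qed.

(** A vector in the kernel of the Gram matrix would have length 0. *)
Lemma riem_metric_unit (g : riem_metric M) p : g p \in unitmx.
Proof.
rewrite -row_free_unit -kermx_eq0; apply/negPn/negP => /rowV0Pn[u uK u0].
have ug : u *m g p = 0 by apply/sub_kermxP.
have := rm_pos g p (v := u^T); rewrite /bil trmxK ug mul0mx mxE ltxx.
by rewrite -trmx_eq0 trmxK => /(_ u0).
Qed.

Lemma metric_coord_unit (g : riem_metric M) i x :
  (mchart i @` mdom i) x -> metric_coord g i x \in unitmx.
Proof.
move=> ix; have T := tcoord_unit (minv_dom ix).
by rewrite /metric_coord !unitmx_mul unitmx_tr unitmx_inv T riem_metric_unit.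
Qed.

End Charts.

(** * Conformal metrics on surfaces *)

Section Conformal.
Context {R : realType}.

Lemma J0_invariant_scalar (H : 'M[R]_2) : H^T = H ->
  (forall v w, bil H (J0 *m v) (J0 *m w) = bil H v w) -> H = (H 0 0)%:M.
Proof.
move=> sH JH.
have H11 : H 1 1 = H 0 0 by rewrite -!bil_basis -!J0_basis0 JH.
have H01 : H 0 1 = 0.
  have : bil H (basisv 0) (basisv 1) = - H 0 1.
    rewrite -JH J0_basis0 J0_basis1 /bil mulmxN mxE -/(bil _ _ _) bil_basis.
    by rewrite -[in LHS]sH mxE.
  by rewrite bil_basis => /eqP; rewrite -addr_eq0 -mulr2n mulrn_eq0 => /eqP.
have H10 : H 1 0 = 0 by rewrite -sH mxE.
apply/matrixP => i j; rewrite mxE.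
case: i => -[|[|//]] i2; case: j => -[|[|//]] j2 /=;
  rewrite ?mulr1n ?mulr0n;
  [rewrite -[RHS]/(H 0 0)|rewrite -[RHS]H01|rewrite -[RHS]H10|rewrite
    -[RHS]H11];
  by congr (H _ _); apply: val_inj.
Qed.

(** A change of chart commutes with [J0], so the invariance of the metric under
    [J0] passes from the preferred charts to every chart. *)
Lemma conformal_metric_coord (M : riemann_surface R) (h : riem_metric M)
    (i : midx M) x : in_conformal_class h -> (mchart i @` mdom i) x ->
  metric_coord h i x = (metric_coord h i x 0 0)%:M.
Proof.
move=> conf ix; apply: J0_invariant_scalar; first exact: metric_coord_sym.
rewrite /metric_coord; set p := minv i x => v w.
have ip : mdom i p := minv_dom ix.
have uT := tcoord_unit ip; set T := tcoord i p in uT *.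
have TJ : T *m J0 = J0 *m T.
  by apply: rs_holomorphic; exists p => //; split => //; exact: mat_dom.
have SJ (z : 'cV[R]_2) : invmx T *m (J0 *m z) = J0 *m (invmx T *m z).
  rewrite !mulmxA; congr (_ *m z).
  rewrite -[LHS](mulmxK uT) -(mulmxA _ J0 T) -TJ (mulmxA _ T J0).
  by rewrite mulVmx// mul1mx.
have E y z : bil ((invmx T)^T *m h p *m invmx T) y z =
    bil (h p) (invmx T *m y) (invmx T *m z).
  by rewrite /bil trmx_mul !mulmxA.
by rewrite !E !SJ conf.
Qed.

Lemma koszul_conformal (B : 'I_2 -> 'M[R]_2) (d : 'I_2 -> R) :
  (forall l, B l = (d l)%:M) ->
  koszul (B 0) (B 0) B (basisv 0) (basisv 0)
  + koszul (B 1) (B 1) B (basisv 1) (basisv 1) = 0.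
Proof.
move=> Bd; apply/colP => l; rewrite !mxE !bil_basis !Bd !mxE.
have e01 : (0 == 1 :> 'I_2) = false by [].
have e10 : (1 == 0 :> 'I_2) = false by [].
have [->|->] : l = 0 \/ l = 1.
  by case: l => -[|[|//]] l2; [left|right]; apply: val_inj.
  by rewrite !eqxx !e10 !mulr1n !mulr0n; field.
by rewrite !eqxx !e01 !mulr1n !mulr0n; field.
Qed.

(** The trace of the Christoffel symbols of a conformal metric in dimension [d]
    is a multiple of [d - 2] times the gradient of the conformal factor. *)
Lemma christoffel_conformal (W : set 'cV[R]_2) (H : 'cV[R]_2 -> 'M[R]_2) x :
  open W -> W x -> differentiable H x ->
  (forall y, W y -> H y = (H y 0 0)%:M) ->
  christoffel H x (basisv 0) (basisv 0) + christoffel H x (basisv 1) (basisv 1)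
  = 0.
Proof.
move=> oW Wx dH HW; rewrite !christoffelE -mulmxDr.
have D l : 'D_(basisv l) H x = ('D_(basisv l) (fun y => H y 0 0) x)%:M.
  apply/matrixP => i j; rewrite [RHS]mxE.
  rewrite deriv_mxE// (@near_eq_derive _ _ _ _ (fun y => H y 0 0 *+ (i == j))).
    by case: (i == j); rewrite ?mulr1n// mulr0n; exact: derive_cst.
  by apply: open_near_eq Wx _ => // y Wy; rewrite [in LHS]HW// mxE.
by rewrite (koszul_conformal D) mulmx0.
Qed.

Lemma sum_I2 (W : zmodType) (F : 'I_2 -> W) : \sum_a F a = F 0 + F 1.
Proof.
rewrite !big_ord_recl big_ord0 addr0; congr (_ + F _); exact: val_inj.
Qed.

(** As the trace of the Christoffel symbols is zero, first derivatives of [f]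
    drop out of the Laplacian. *)
Lemma tension_conformal m (W : set 'cV[R]_2) (H : 'cV[R]_2 -> 'M[R]_2)
    (G : 'cV[R]_m -> 'M[R]_m) (f : 'cV[R]_2 -> 'cV[R]_m) x :
  open W -> W x -> differentiable H x ->
  (forall y, W y -> H y = (H y 0 0)%:M) -> differentiable f x ->
  let sff e := 'D_e (fun y => 'D_e f y) x
               + christoffel G (f x) ('D_e f x) ('D_e f x) in
  tension H G f x = (H x 0 0)^-1 *: (sff (basisv 0) + sff (basisv 1)).
Proof.
move=> oW Wx dH HW df sff; rewrite /tension.
have invH : invmx (H x) = (H x 0 0)^-1%:M by rewrite [in LHS]HW// invmx_scalar.
have S e : second_fund_form H G f x e e = sff e - 'D_(christoffel H x e e) f x.
  by rewrite /second_fund_form /sff addrAC.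
have D0 : 'D_(christoffel H x (basisv 0) (basisv 0)) f x +
    'D_(christoffel H x (basisv 1) (basisv 1)) f x = 0.
  by rewrite -(deriveDl _ _ df) (christoffel_conformal oW Wx dH HW) derive0.
have -> : sff (basisv 0) + sff (basisv 1) =
    \sum_a second_fund_form H G f x (basisv a) (basisv a).
  rewrite sum_I2 (S (basisv 0)) (S (basisv 1)).
  move: (sff _) (sff _) ('D_(_ _ _ _ _) f x) ('D_(_ _ _ _ _) f x) D0 =>
    a b c d cd.
  by rewrite addrACA -opprD cd subr0.
rewrite scaler_sumr; apply: eq_bigr => a _.
rewrite (bigD1 a)//= big1 ?addr0 => [|b ba]; rewrite invH mxE.
  by rewrite eqxx.
by rewrite eq_sym (negbTE ba) mulr0n scale0r.
Qed.

End Conformal.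

(** * Families of maps into the twistor space *)

Section Twistor.
Context {R : realType} {n : nat} {N : manifold R n.*2} {g : riem_metric N}
  {o : orientation N}.

Lemma tw_coord_sq (j : midx N) (z : twistor g o) : tw_dom j z ->
  (tw_coord j z).2 *m (tw_coord j z).2 = - 1%:M.
Proof.
move=> jz; have uT := tcoord_unit (jz : mdom j (tw_base z)).
rewrite /tw_coord /=; set T := tcoord j _ in uT *.
rewrite !mulmxA mulmxKV// -(mulmxA T) tw_square mulmxN mulmx1 mulNmx.
by rewrite mulmxV.
Qed.

Lemma smooth_base_family {m} {M : manifold R m} (I : set R)
    (psi : R -> M -> twistor g o) :
  smooth_tw_family I psi -> smooth_family I (fun t p => tw_base (psi t p)).
Proof.
move=> spsi t p i j It ip jp;
  have [D [F [oO Ox sF FE]]] := spsi t p i j It ip jp.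
exists D, (fst \o F); split=> //.
  exact: (smooth_lin oO (L := fst) (@continuous_fst _ _ _) sF).
by move=> s x Osx Is; have [ix jx E] := FE s x Osx Is; split=> //;
  rewrite /= -E.
Qed.

End Twistor.

Section FirstOrder.
Context (R : realType) (n : nat) (N : manifold R n.*2) (g : riem_metric N)
  (o : orientation N) (M : riemann_surface R) (h : riem_metric M)
  (h_conf : in_conformal_class h).
Variables (I : set R) (psi : R -> M -> twistor g o).
Hypothesis psi_hol : J2_holomorphic_to_first_order I psi.
Variables (i : midx M) (j : midx N).
Local Notation Z := (R^o * 'cV[R]_2)%type.
Let phi t p : N := tw_base (psi t p).

(* As [O] is open and [F] is the family read in the two charts at every point
   of [O], the derivatives of [F] are those of the family. *)
Variables (O : set Z) (F : Z -> EndCoord R n.*2).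
Hypotheses (oO : open O) (sF : smooth_on O F).
Hypothesis repF : forall s x, O (s, x) ->
  [/\ (mchart i @` mdom i) x, tw_dom j (psi s (minv i x))
    & tw_coord j (psi s (minv i x)) = F (s, x)].

Let U := mchart j @` mdom j.
Let G := metric_coord g j.
Let e (b : 'I_2) : Z := ((0 : R^o), basisv b).
Let f : Z -> 'cV[R]_(n.*2) := fst \o F.

Let FU z : O z -> U (F z).1.
Proof. by case: z => s x /repF[_ jx <-]; exact: chart_img. Qed.

Let sqF z : O z -> (F z).2 *m (F z).2 = - 1%:M.
Proof. by case: z => s x /repF[_ jx <-]; exact: tw_coord_sq. Qed.

Let near_slice s x : O (s, x) -> \forall y \near x, O (s, y).
Proof. by move=> Ox; exact: open_nbhs_nbhs (conj (open_slice s oO) Ox). Qed.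

Let near_time s x : O (s, x) -> \forall r \near s, O (r, x).
Proof.
move=> Ox; have c1 : r @[r --> s] --> (s : R^o) by exact: cvg_id.
have c2 : x @[_ --> (s : R)] --> x by exact: cvg_cst.
exact: (cvg_pair c1 c2 (open_nbhs_nbhs (conj oO Ox))).
Qed.

Lemma J2_defect_local s x X : O (s, x) ->
  J2_defect i j (psi s) x X = local_defect G F X (s, x).
Proof.
move=> Ox; have D v : 'D_v (fun y => tw_coord j (psi s (minv i y))) x =
    'D_((0 : R^o), v) F (s, x).
  rewrite derive_slice; apply: near_eq_derive.
  by apply: filterS (near_slice Ox) => y /repF[].
by rewrite /J2_defect !D; have [_ _ ->] := repF Ox.
Qed.

Lemma flat_family_tension x : O (0, x) ->
  flat ((1 : R^o), (0 : 'cV[R]_2)) (euclidean_tension G f (e 0) (e 1)) (0, x).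
Proof.
have [spsi hol0 hol1] := psi_hol.
have oU : open U by exact: m_open_img.
have uG y : U y -> G y \in unitmx by exact: metric_coord_unit.
have sG : smooth_on U G by exact: rm_smooth.
have symG y : (G y)^T = G y by exact: metric_coord_sym.
have d0 y X : O (0, y) -> local_defect G F X (0, y) = 0.
  move=> Oy; have [iy jy _] := repF Oy; rewrite -J2_defect_local//.
  by have := hol0 _ i j (minv_dom iy) jy X; rewrite minvK.
apply: (flat_tension_of_flat_defect oU sG uG symG oO sF FU sqF) => // y X Oy.
have [iy jy _] := repF Oy.
have := hol1 _ i j (minv_dom iy) jy X; rewrite minvK// => tw.
have E : {near (0 : R), (fun r : R => local_defect G F X (r, y)) =1
                        (fun t => J2_defect i j (psi t) y X)}.
  by apply: filterS (near_time Oy) => r Or; rewrite J2_defect_local.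
have Ec : {near (0 : R), (fun r : R => F (r, y)) =1
                         (fun t => tw_coord j (psi t (minv i y)))}.
  by apply: filterS (near_time Oy) => r /repF[].
rewrite derive_time (near_eq_derive _ E).
apply: tw_cov_deriv_eq0 tw.
- apply: near_eq_differentiable Ec _; apply: differentiable_time.
  exact: smooth_differentiable sF Oy.
- apply: near_eq_differentiable E _; apply: differentiable_time.
  exact: (differentiable_local_defect oU sG uG symG oO sF FU X Oy).
- by rewrite J2_defect_local// d0.
Qed.

Lemma tension_local s x : O (s, x) ->
  tension_coord h g i j (phi s) x =
  (metric_coord h i x 0 0)^-1 *: euclidean_tension G f (e 0) (e 1) (s, x).
Proof.
move=> Ox; have [ix jx Fx] := repF Ox.
have sf : smooth_on O f.
  exact: (smooth_lin oO (L := fst) (@continuous_fst _ _ _) sF).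
have E : {near x, (fun y => f (s, y)) =1 map_coord i j (phi s)}.
  by apply: filterS (near_slice Ox) => y /repF[_ _ Fy]; rewrite /f /= -Fy.
have Ex : map_coord i j (phi s) x = f (s, x) := esym (nbhs_singleton E).
have D b y : O (s, y) -> 'D_(basisv b)
  (map_coord i j (phi s)) y = 'D_(e b) f (s, y).
  move=> Oy; rewrite derive_slice; apply/esym/near_eq_derive.
  by apply: filterS (near_slice Oy) => w /repF[_ _ Fw]; rewrite /f /= -Fw.
have DD b : 'D_(basisv b) (fun y => 'D_(basisv b) (map_coord i j (phi s)) y) x =
    'D_(e b) (fun z => 'D_(e b) f z) (s, x).
  rewrite derive_slice; apply: near_eq_derive.
  by apply: filterS (near_slice Ox) => y; exact: D.
have dfx : differentiable (map_coord i j (phi s)) x.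
  apply: near_eq_differentiable E _.
  apply: (differentiable_comp (f := fun y : 'cV[R]_2 =>
    ((s : R^o), y)) (g := f)).
    by apply: differentiable_pair.
  exact: smooth_differentiable sf Ox.
have dG : differentiable G (f (s, x)).
  exact: (smooth_differentiable (rm_smooth g j) (FU Ox)).
have K b : 'D_(basisv b) (fun y => 'D_(basisv b) (map_coord i j (phi s)) y) x +
    christoffel G (map_coord i j (phi s) x)
      ('D_(basisv b) (map_coord i j (phi s)) x)
      ('D_(basisv b) (map_coord i j (phi s)) x) =
    cov_base G f (e b) (fun y => 'D_(e b) f y) (s, x).
  rewrite (D b x Ox) Ex -(christoffel_mxE _ _ dG).
  exact: (congr1 (fun w => w + _) (DD b)).
rewrite /tension_coord.
rewrite (tension_conformal (W := mchart i @` mdom i) _ _ ix).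
- exact: (congr1 (fun w => (metric_coord h i x 0 0)^-1 *: w)
    (congr2 +%R (K 0) (K 1))).
- exact: m_open_img.
- exact: (smooth_differentiable (rm_smooth h i) ix).
- by move=> y iy; exact: conformal_metric_coord.
- exact: dfx.
Qed.

Lemma tension_first_order x : O (0, x) ->
  [/\ tension_coord h g i j (phi 0) x = 0 &
      derive1 (fun t => tension_coord h g i j (phi t) x) 0 = 0].
Proof.
move=> Ox; have [dL L0 DL] := flat_family_tension Ox.
have T0 : tension_coord h g i j (phi 0) x = 0.
  by rewrite tension_local// L0 scaler0.
split=> //; rewrite derive1E.
have E : {near (0 : R), (fun t => tension_coord h g i j (phi t) x) =1
  (fun r : R => (metric_coord h i x 0 0)^-1 *:
                euclidean_tension G f (e 0) (e 1) (r, x))}.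
  by apply: filterS (near_time Ox) => r; exact: tension_local.
rewrite (near_eq_derive _ E).
rewrite derive_time in DL.
have dt : derivable (fun r : R => euclidean_tension G f (e 0) (e 1) (r, x)) 0 1.
  by apply: diff_derivable; exact: differentiable_time dL.
rewrite [LHS](@deriveZ _ _ _ (fun r : R =>
  euclidean_tension G f (e 0) (e 1) (r, x)))//.
by rewrite DL scaler0.
Qed.

End FirstOrder.

Theorem theoremV2p18 (R : realType) (n : nat) (N : manifold R n.*2)
    (g : riem_metric N) (o : orientation N)
    (M : riemann_surface R) (h : riem_metric M) (h_conf : in_conformal_class h)
    (I : set R) (I_interval : is_interval I) (I_around0 : nbhs (0 : R) I)
    (psi : R -> M -> twistor g o)
    (psi_hol : J2_holomorphic_to_first_order I psi) :
  harmonic_to_first_order h g I (fun t p => tw_base (psi t p)).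
Proof.
have [spsi _ _] := psi_hol.
have local p (i : midx M)
  (j : midx N) : mdom i p -> mdom j (tw_base (psi 0 p)) ->
  [/\ tension_coord h g i j (fun p => tw_base (psi 0 p)) (mchart i p) = 0 &
      derive1 (fun t => tension_coord h g i j (fun p => tw_base (psi t p))
        (mchart i p)) 0 = 0].
  move=> ip jp.
  have [D [F [oO Ox sF FE]]] := spsi 0 p i j (nbhs_singleton I_around0) ip jp.
  (* F represents the family only at times in I; restricting it to interior
     times leaves an open set on which it does so everywhere *)
  pose O' := D `&` (fst @^-1` I^°).
  have oO' : open O'.
    apply: openI => //; apply: open_comp; last exact: open_interior.
    by move=> z _; exact: continuous_fst.
  apply: (tension_first_order h_conf psi_hol oO') => //.
  - by apply: smooth_sub sF => z [].
  - by move=> s x [Osx Is]; apply: FE => //; exact: interior_subset Is.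
split.
- exact: smooth_base_family.
- by move=> p i j ip jp; have [] := local p i j ip jp.
- move=> p i j ip jp x; have [T0 T1] := local p i j ip jp.
  by rewrite /cov_deriv T1 T0 christoffel0r addr0.
Qed.
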